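(* The only $5$-dimensional solvable Lie algebras admitting a $K$-contact hypo structure or a hypo-contact $\eta$-Einstein structure are, up to isomorphism, the Lie algebras $\mathfrak h_1$ and $\mathfrak h_3$ given in a basis $X_1,\dots,X_5$ by the nonzero brackets (up to skew-symmetry) $$\mathfrak h_1:\ [X_1,X_4]=[X_2,X_3]=X_5;$$ $$\mathfrak h_3:\ \tfrac12[X_1,X_4]=[X_2,X_3]=X_1,\quad [X_2,X_4]=[X_3,X_5]=X_2,\quad [X_2,X_5]=-[X_3,X_4]=-X_3.$$
   Context: For a real Lie algebra $\mathfrak g$, $d$ is the Chevalley–Eilenberg differential ($d\alpha(X,Y)=-\alpha([X,Y])$). An $SU(2)$-structure on a $5$-dimensional Lie algebra $\mathfrak g$ is a quadruplet $(\eta,\omega_1,\omega_2,\omega_3)$, $\eta\in\mathfrak g^*$, $\omega_i\in\Lambda^2\mathfrak g^*$, for which there is a basis $e^1,\dots,e^5$ of $\mathfrak g^*$ with $\eta=e^5$, $\omega_1=e^{12}+e^{34}$, $\omega_2=e^{13}+e^{42}$, $\omega_3=e^{14}+e^{23}$; the associated (left-invariant) metric is $g=\sum_i(e^i)^2$. It is hypo-contact if $d\eta=-2\omega_3$, $d(\eta\wedge\omega_1)=0$, $d(\eta\wedge\omega_2)=0$. Let $\xi$ be the vector dual to $\eta$ with respect to $g$. A $K$-contact hypo structure is a hypo-contact structure for which $\xi$ is a Killing vector field of $g$. A hypo-contact structure is $\eta$-Einstein if there are functions (here constants) $\tau,\nu$ with $\mathrm{Ric}(X,Y)=\tau\,g(X,Y)+\nu\,\eta(X)\eta(Y)$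 for all $X,Y$. *)

(* Defs.v *)
From HB Require Import structures.
From mathcomp Require Import all_boot all_order all_algebra.
From mathcomp Require Import ring.
From mathcomp Require Import reals.

Set Implicit Arguments.
Unset Strict Implicit.
Unset Printing Implicit Defensive.

Import GRing.Theory.
Local Open Scope ring_scope.

Record lieAlgebra (R : fieldType) (V : vectType R) := LieAlgebra {
  bracket :> V -> V -> V;
  bracket_linear : forall y, linear (bracket^~ y);
  bracket_alt : forall x, bracket x x = 0;
  bracket_jacobi : forall x y z,
    bracket x (bracket y z) + bracket y (bracket z x)
      + bracket z (bracket x y) = 0
}.

Definition lie_isomorphic (R : fieldType) (V W : vectType R)
    (L : lieAlgebra V) (M : lieAlgebra W) : Prop :=
  exists f : 'Hom(V, W),
    bijective f /\ forall x y, f (L x y) = M (f x) (f y).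

Section Solvable.
Variables (R : fieldType) (V : vectType R) (L : lieAlgebra V).

(* By bilinearity, the brackets of two bases span [U, W]. *)
Definition bracketv (U W : {vspace V}) : {vspace V} :=
  <<[seq L x y | x <- vbasis U, y <- vbasis W]>>%VS.

Definition derived_series (n : nat) : {vspace V} :=
  iter n (fun U => bracketv U U) fullv.

Definition lie_solvable : Prop := exists n, derived_series n = 0%VS.

End Solvable.

(* A k-form is represented by its function of k vectors.  The wedge product is
   the shuffle one, e.g. (a /\ b)(X, Y) = a(X) b(Y) - a(Y) b(X), without any
   factor 1/2; the Chevalley-Eilenberg differential is
   da(X_0, ..., X_k) =
     sum_(i < j) (-1)^(i + j) a([X_i, X_j], X_0, ..., ^i, ..., ^j, ..., X_k). *)
Section Forms.
Variables (R : realType) (V : vectType R) (L : lieAlgebra V).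

Definition wedge11 (a b : V -> R) (X Y : V) : R := a X * b Y - a Y * b X.

Definition wedge12 (a : V -> R) (w : V -> V -> R) (X Y Z : V) : R :=
  a X * w Y Z - a Y * w X Z + a Z * w X Y.

Definition d1 (a : V -> R) (X Y : V) : R := - a (L X Y).

Definition d3 (c : V -> V -> V -> R) (X0 X1 X2 X3 : V) : R :=
  - c (L X0 X1) X2 X3 + c (L X0 X2) X1 X3 - c (L X0 X3) X1 X2
  - c (L X1 X2) X0 X3 + c (L X1 X3) X0 X2 - c (L X2 X3) X0 X1.

End Forms.

Section SU2.
Variables (R : realType) (V : vectType R) (L : lieAlgebra V).

(* Indices are shifted by one: e`_0, ..., e`_4 stand for e^1, ..., e^5.  That
   w1, w2, w3 are alternating bilinear follows from the last three clauses. *)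
Definition adapted_coframe (e : 5.-tuple 'Hom(V, R^o))
    (eta : 'Hom(V, R^o)) (w1 w2 w3 : V -> V -> R) : Prop :=
  [/\ basis_of fullv e,
      eta = e`_4,
      forall X Y, w1 X Y = wedge11 e`_0 e`_1 X Y + wedge11 e`_2 e`_3 X Y,
      forall X Y, w2 X Y = wedge11 e`_0 e`_2 X Y + wedge11 e`_3 e`_1 X Y &
      forall X Y, w3 X Y = wedge11 e`_0 e`_3 X Y + wedge11 e`_1 e`_2 X Y].

(* g does not depend on the choice of the adapted coframe. *)
Definition associated_metric (g : V -> V -> R)
    (eta : 'Hom(V, R^o)) (w1 w2 w3 : V -> V -> R) : Prop :=
  exists2 e : 5.-tuple 'Hom(V, R^o), adapted_coframe e eta w1 w2 w3 &
    forall X Y, g X Y = \sum_(i < 5) (e`_i X : R) * (e`_i Y : R).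

Definition SU2_structure
    (eta : 'Hom(V, R^o)) (w1 w2 w3 : V -> V -> R) : Prop :=
  exists e : 5.-tuple 'Hom(V, R^o), adapted_coframe e eta w1 w2 w3.

Definition hypo_contact
    (eta : 'Hom(V, R^o)) (w1 w2 w3 : V -> V -> R) : Prop :=
  [/\ SU2_structure eta w1 w2 w3,
      forall X Y, d1 L eta X Y = - 2 * w3 X Y,
      forall X Y Z T, d3 L (wedge12 eta w1) X Y Z T = 0 &
      forall X Y Z T, d3 L (wedge12 eta w2) X Y Z T = 0].

(* The Lie derivative of the left-invariant metric g along the left-invariant
   vector field xi vanishes; the term xi(g(X, Y)) is zero, g(X, Y) being
   constant for X, Y left-invariant. *)
Definition killing (g : V -> V -> R) (xi : V) : Prop :=
  forall X Y, - g (L xi X) Y - g X (L xi Y) = 0.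

Definition K_contact_hypo
    (eta : 'Hom(V, R^o)) (w1 w2 w3 : V -> V -> R) : Prop :=
  hypo_contact eta w1 w2 w3 /\
  exists (g : V -> V -> R) (xi : V),
    [/\ associated_metric g eta w1 w2 w3,
        forall X, g xi X = eta X &
        killing g xi].

(* The torsion-free metric connection, restricted to left-invariant vector
   fields (so that X(g(Y, Z)) = 0 in the compatibility condition). *)
Definition levi_civita (g : V -> V -> R) (nabla : V -> V -> V) : Prop :=
  [/\ forall Y, linear (nabla^~ Y),
      forall X, linear (nabla X),
      forall X Y, nabla X Y - nabla Y X = L X Y &
      forall X Y Z, g (nabla X Y) Z + g Y (nabla X Z) = 0].

Definition curvature (nabla : V -> V -> V) (X Y Z : V) : V :=
  nabla X (nabla Y Z) - nabla Y (nabla X Z) - nabla (L X Y) Z.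

(* The trace of a linear endomorphism, computed in the basis vbasis fullv. *)
Definition trace (f : V -> V) : R :=
  \sum_(i < \dim {:V}) coord (vbasis {:V}) i (f (vbasis {:V})`_i).

Definition ricci (nabla : V -> V -> V) (X Y : V) : R :=
  trace (fun Z => curvature nabla Z X Y).

Definition hypo_contact_eta_Einstein
    (eta : 'Hom(V, R^o)) (w1 w2 w3 : V -> V -> R) : Prop :=
  hypo_contact eta w1 w2 w3 /\
  exists (g : V -> V -> R) (nabla : V -> V -> V),
    [/\ associated_metric g eta w1 w2 w3,
        levi_civita g nabla &
        exists tau nu : R, forall X Y,
          ricci nabla X Y = tau * g X Y + nu * (eta X : R) * (eta Y : R)].

End SU2.

Section Models.
Variable R : realType.

(* 1-based: X_1, ..., X_5 is the canonical basis of R^5, and w i j applied to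
   x, y is the coefficient x_i y_j - x_j y_i of [X_i, X_j] in [x, y]. *)
Definition X_ (k : nat) : 'rV[R]_5 := delta_mx 0 (inord k.-1).
Definition minor (x y : 'rV[R]_5) (i j : nat) : R :=
  x 0 (inord i.-1) * y 0 (inord j.-1) - x 0 (inord j.-1) * y 0 (inord i.-1).

Definition h1_bracket (x y : 'rV[R]_5) : 'rV[R]_5 :=
  let w := minor x y in w 1 4 *: X_ 5 + w 2 3 *: X_ 5.

Definition h3_bracket (x y : 'rV[R]_5) : 'rV[R]_5 :=
  let w := minor x y in
  w 1 4 *: (2 *: X_ 1) + w 2 3 *: X_ 1
  + w 2 4 *: X_ 2 + w 3 5 *: X_ 2
  + w 2 5 *: (- X_ 3) + w 3 4 *: X_ 3.

Let inord_eq (i j : nat) : (i < 5)%N -> (j < 5)%N ->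
  (inord i == inord j :> 'I_5) = (i == j).
Proof. by move=> i5 j5; rewrite -val_eqE /= !inordK. Qed.

Fact h1_linear y : linear (h1_bracket^~ y).
Proof.
by move=> a x z; apply/rowP=> k; rewrite /h1_bracket /minor !mxE; ring.
Qed.

Fact h1_alt x : h1_bracket x x = 0.
Proof. by apply/rowP=> k; rewrite /h1_bracket /minor !mxE; ring. Qed.

Fact h1_jacobi x y z :
  h1_bracket x (h1_bracket y z) + h1_bracket y (h1_bracket z x)
    + h1_bracket z (h1_bracket x y) = 0.
Proof.
by apply/rowP=> k; rewrite /h1_bracket /minor !(mxE, eqxx, inord_eq) //=; ring.
Qed.

Definition h1 : lieAlgebra 'rV[R]_5 := LieAlgebra h1_linear h1_alt h1_jacobi.

Fact h3_linear y : linear (h3_bracket^~ y).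
Proof.
by move=> a x z; apply/rowP=> k; rewrite /h3_bracket /minor !mxE; ring.
Qed.

Fact h3_alt x : h3_bracket x x = 0.
Proof. by apply/rowP=> k; rewrite /h3_bracket /minor !mxE; ring. Qed.

Let h3_coord x y (u := h3_bracket x y) (w := minor x y) :
  [/\ u 0 (inord 0) = 2 * w 1 4 + w 2 3, u 0 (inord 1) = w 2 4 + w 3 5,
      u 0 (inord 2) = w 3 4 - w 2 5, u 0 (inord 3) = 0 & u 0 (inord 4) = 0].
Proof.
by split; rewrite /u /h3_bracket -/w !(mxE, eqxx, inord_eq) //=; ring.
Qed.

Fact h3_jacobi x y z :
  h3_bracket x (h3_bracket y z) + h3_bracket y (h3_bracket z x)
    + h3_bracket z (h3_bracket x y) = 0.
Proof.
have [] := (h3_coord y z, h3_coord z x, h3_coord x y).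
move: (h3_bracket y z) (h3_bracket z x) (h3_bracket x y) => u v t.
move=> [[u1 u2 u3 u4 u5] [v1 v2 v3 v4 v5]] [t1 t2 t3 t4 t5].
apply/rowP=> k; rewrite /h3_bracket !mxE /minor /=.
by rewrite u1 u2 u3 u4 u5 v1 v2 v3 v4 v5 t1 t2 t3 t4 t5 /minor /=; ring.
Qed.

Definition h3 : lieAlgebra 'rV[R]_5 := LieAlgebra h3_linear h3_alt h3_jacobi.

End Models.

(* Main.v *)
From HB Require Import structures.
Require Import Defs.
From mathcomp Require Import all_boot all_order all_algebra reals.
From mathcomp Require Import ring lra.

(* Let H = ker eta, identified with the quaternions so that w1, w2, w3 are the
   forms of the left multiplications by i, j, k.  The closedness of the three
   forms on H says that the torsion-free metric connection attached to the
   H-part of the bracket is hyperkaehler, i.e. acts by right multiplications: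
     [X, Y] = Y A(X) - X A(Y) + 2 w3(X, Y) xi,   [xi, X] = D X,
   with A : H -> Im H linear and D in sp(H, w3).
   Solvability yields a closed 1-form, which a right multiplication by a unit
   quaternion brings to e^1 + b e^5; this leaves for A a symmetric 3 x 3 matrix
   and b, and a rotation of the (e_2, e_3)-plane removes two of the entries.
   If D e_1 = (0, x, y, z), then Ric(e_1, e_1) - Ric(e_4, e_4)
   = 4 z - x^2 - y^2 - z^2, whereas the Killing condition is x = y = z = 0.
   The Jacobi identity forces z <= 0, so both geometric hypotheses give
   D e_1 = 0.  What remains is A = 0 (giving h1), a two-parameter family
   isomorphic to h3, and a family containing a simple 3-dimensional
   subalgebra. *)

Import Order.TTheory GRing.Theory Num.Theory.
Local Open Scope ring_scope.

Set Implicit Arguments.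
Unset Strict Implicit.

(** * Frames and structure constants *)

Section Frames.
Variables (R : realType) (V : vectType R).
Implicit Types (E : nat -> V) (e : nat -> V -> R).

(** Indices are natural numbers rather than ordinals so that they can be split by cases; duality and
    span constrain the first five only. *)
Record frame E e : Prop := Frame {
  frame_scalar : forall i, scalar (e i);
  frame_dual : forall i j, (i < 5)%N -> (j < 5)%N -> e i (E j) = (i == j)%:R;
  frame_span : forall x, x = \sum_(i < 5) e i x *: E i
}.

Variables (E : nat -> V) (e : nat -> V -> R).
Hypothesis Ee : frame E e.

Lemma frameD i x y : e i (x + y) = e i x + e i y.
Proof. by have := frame_scalar Ee i 1 x y; rewrite scale1r mul1r. Qed.

Lemma frame0 i : e i 0 = 0.
Proof. by apply: (addIr (e i 0)); rewrite -frameD !add0r. Qed.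

Lemma frameZ i a x : e i (a *: x) = a * e i x.
Proof. by have := frame_scalar Ee i a x 0; rewrite frame0 !addr0. Qed.

Lemma frameN i x : e i (- x) = - e i x.
Proof. by rewrite -scaleN1r frameZ mulN1r. Qed.

Lemma frame_sum i n (F : 'I_n -> V) : e i (\sum_k F k) = \sum_k e i (F k).
Proof. exact: (big_morph _ (frameD i) (frame0 i)). Qed.

Definition frameE := (frameD, frameZ, frameN, frame0).

Lemma frame_inj x y : (forall i, (i < 5)%N -> e i x = e i y) -> x = y.
Proof.
move=> H; rewrite (frame_span Ee x) (frame_span Ee y).
by apply: eq_bigr => i _; rewrite H.
Qed.

(** Basis independence of the trace: the vectors of [vbasis] are expanded in the frame, each
    [f (E j)] in [vbasis], and the two sums are exchanged. *)
Lemma traceE (f : V -> V) : linear f -> trace f = \sum_(i < 5) e i (f (E i)).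
Proof.
move=> lf.
have fD x y : f (x + y) = f x + f y by have := lf 1 x y; rewrite !scale1r.
have f0 : f 0 = 0 by apply: (addIr (f 0)); rewrite -fD !add0r.
have fZ a x : f (a *: x) = a *: f x by have := lf a x 0; rewrite f0 !addr0.
have fS n (F : 'I_n -> V) : f (\sum_k F k) = \sum_k f (F k).
  exact: (big_morph _ fD f0).
rewrite /trace.
transitivity (\sum_(i < \dim {:V}) \sum_(j < 5)
    e j ((vbasis {:V})`_i) * coord (vbasis {:V}) i (f (E j))).
  apply: eq_bigr => i _; rewrite {1}[(vbasis _)`_i](frame_span Ee).
  by rewrite fS linear_sum; apply: eq_bigr => j _; rewrite fZ linearZ.
rewrite exchange_big; apply: eq_bigr => j _ /=.
rewrite [in RHS](coord_vbasis (memvf (f (E j)))) frame_sum.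
by apply: eq_bigr => i _; rewrite frameZ mulrC.
Qed.

End Frames.

Section Bracket.
Variables (R : fieldType) (V : vectType R) (L : lieAlgebra V).

Lemma bracketDl x y z : L (x + y) z = L x z + L y z.
Proof. by have := bracket_linear L z 1 x y; rewrite !scale1r. Qed.

Lemma bracket0l z : L 0 z = 0.
Proof. by apply: (addIr (L 0 z)); rewrite -bracketDl !add0r. Qed.

Lemma bracketZl a x z : L (a *: x) z = a *: L x z.
Proof. by have := bracket_linear L z a x 0; rewrite bracket0l !addr0. Qed.

Hypothesis Lr : forall x, linear (L x).

Lemma bracketDr x y z : L x (y + z) = L x y + L x z.
Proof. by have := Lr x 1 y z; rewrite !scale1r. Qed.

Lemma bracketC x y : L x y = - L y x.
Proof.
apply/eqP; rewrite -addr_eq0; apply/eqP.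
have := bracket_alt L (x + y).
by rewrite bracketDl !bracketDr !bracket_alt add0r addr0.
Qed.

Lemma bracketZr a x z : L x (a *: z) = a *: L x z.
Proof. by rewrite bracketC bracketZl (bracketC z) scalerN opprK. Qed.

Lemma bracket_suml n (F : 'I_n -> V) y : L (\sum_k F k) y = \sum_k L (F k) y.
Proof.
exact: (big_morph (fun x => L x y) (fun u v => bracketDl u v y) (bracket0l y)).
Qed.

Lemma bracket_sumr n (F : 'I_n -> V) x : L x (\sum_k F k) = \sum_k L x (F k).
Proof.
by rewrite bracketC bracket_suml -sumrN; apply: eq_bigr => k _; rewrite -bracketC.
Qed.

End Bracket.

Section StructureConstants.
Variables (R : realType) (V : vectType R) (L : lieAlgebra V).
Variables (E : nat -> V) (e : nat -> V -> R).
Hypotheses (Ee : frame E e) (Lr : forall x, linear (L x)).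

Definition sconst i j k : R := e k (L (E i) (E j)).

Lemma bracket_coordE k x y :
  e k (L x y) = \sum_(i < 5) \sum_(j < 5) e i x * (e j y * sconst i j k).
Proof.
rewrite {1}(frame_span Ee x) {1}(frame_span Ee y) bracket_suml (frame_sum Ee).
apply: eq_bigr => i _; rewrite (bracket_sumr Lr) (frame_sum Ee).
apply: eq_bigr => j _.
by rewrite bracketZl (bracketZr Lr) !(frameZ Ee).
Qed.

Lemma sconstC i j k : sconst i j k = - sconst j i k.
Proof. by rewrite /sconst (bracketC Lr) (frameN Ee). Qed.

Lemma sconst_diag i k : sconst i i k = 0.
Proof. by rewrite /sconst bracket_alt (frame0 Ee). Qed.

Lemma bracket_frameE i y k : e k (L (E i) y) = \sum_(m < 5) e m y * sconst i m k.
Proof.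
rewrite {1}(frame_span Ee y) (bracket_sumr Lr) (frame_sum Ee).
by apply: eq_bigr => j _; rewrite (bracketZr Lr) (frameZ Ee).
Qed.

Lemma sconst_jacobi i j k l :
  \sum_(m < 5) (sconst j k m * sconst i m l + sconst k i m * sconst j m l
    + sconst i j m * sconst k m l) = 0.
Proof.
have /(congr1 (e l)) := bracket_jacobi L (E i) (E j) (E k).
by rewrite !(frameD Ee) (frame0 Ee) !bracket_frameE -!big_split.
Qed.

End StructureConstants.

(** * Passage between bases of the dual and frames *)

Section Coframes.
Variables (R : realType) (V : vectType R).

Lemma lin_funE (W : vectType R) (f : V -> W) :
  linear f -> exists h : 'Hom(V, W), forall x, h x = f x.
Proof.
move=> lf; pose lf' := GRing.isLinear.Build R V W *:%R f lf.
pose F : {linear V -> W} := HB.pack f lf'.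
by exists (linfun F) => x; rewrite lfunE.
Qed.

Lemma iso_of_coords (n : nat) (f : V -> 'rV[R]_n) :
  \dim {:V} = n -> linear f -> (forall x, f x = 0 -> x = 0) ->
  exists h : 'Hom(V, 'rV[R]_n), bijective h /\ forall x, h x = f x.
Proof.
move=> dV /lin_funE[h hE] f0; exists h; split=> //.
have h0 : lker h == 0%VS.
  by rewrite -subv0; apply/subvP => x; rewrite memv_ker hE memv0 => /eqP/f0->.
have limgh : limg h = fullv.
  apply/eqP; rewrite -(dimv_leqif_eq (subvf _)) limg_dim_eq; last first.
    by rewrite (eqP h0) capv0.
  by rewrite dV dimvf dim_matrix mul1r.
exists (h^-1)%VF; first exact: lker0_lfunK.
by move=> y; apply: limg_lfunVK; rewrite limgh memvf.
Qed.

(** Evaluating the coframe embeds [V] in R^5, since a vector killed by a basis of the dual is killed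
    by every coordinate form. Equal dimensions make this a bijection, and the preimages of the
    canonical basis form the dual frame. *)
Lemma frame_of_coframe (t : 5.-tuple 'Hom(V, R^o)) :
  \dim {:V} = 5%N -> basis_of fullv t ->
  exists E, frame E (fun i x => t`_i x : R).
Proof.
move=> dV bt.
pose f x : 'rV[R]_5 := \row_(i < 5) (t`_i x : R).
have lf : linear f.
  by move=> a x y; apply/rowP => i; rewrite !mxE linearD linearZ.
have f0 x : f x = 0 -> x = 0.
  move=> fx0.
  have tx0 (h : 'Hom(V, R^o)) : h x = 0.
    have := memvf h; rewrite -(span_basis bt) => /coord_span->.
    rewrite sum_lfunE big1 // => i _; rewrite scale_lfunE.
    have /rowP/(_ i) := fx0; rewrite !mxE => ->.
    by rewrite scaler0.
  rewrite (coord_vbasis (memvf x)) big1 // => i _.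
  have [h hE] := @lin_funE R^o (coord (vbasis {:V}) i) (@linearP _ _ _ _ _).
  by rewrite -hE tx0 scale0r.
have [h [[g hK gK] hE]] := iso_of_coords dV lf f0.
exists (fun i => g (delta_mx 0 (inord i))).
have fg i j : (i < 5)%N -> (t`_i (g (delta_mx 0 j)) : R) = (i == j :> nat)%:R.
  move=> i5; have := hE (g (delta_mx 0 j)); rewrite gK => /rowP/(_ (Ordinal i5)).
  by rewrite !mxE eqxx /= => <-; congr (_%:R); rewrite -val_eqE.
split.
- by move=> i a x y; rewrite linearD linearZ.
- by move=> i j i5 j5; rewrite fg // inordK.
move=> x; apply: (can_inj hK); rewrite !hE; apply/rowP => i.
rewrite !mxE linear_sum /= (bigD1 i) //= linearZ /= fg ?inord_val // eqxx.
rewrite big1 ?addr0 ?mulr1 => [|j ji]; first by rewrite /GRing.scale /= mulr1.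
rewrite linearZ /= fg ?inord_val // val_eqE eq_sym (negPf ji).
by rewrite scaler0.
Qed.

Lemma coframe_of_frame E (e : nat -> V -> R) :
  \dim {:V} = 5%N -> frame E e ->
  exists2 t : 5.-tuple 'Hom(V, R^o),
    basis_of fullv t & forall i x, (i < 5)%N -> (t`_i x : R) = e i x.
Proof.
move=> dV Ee.
have hP i : exists h : 'Hom(V, R^o), forall x, h x = e i x.
  by apply: (@lin_funE R^o (e i)) => a x y; rewrite (frame_scalar Ee).
have [h0 h0E] := hP 0%N; have [h1 h1E] := hP 1%N; have [h2 h2E] := hP 2%N.
have [h3 h3E] := hP 3%N; have [h4 h4E] := hP 4%N.
pose t := [tuple h0; h1; h2; h3; h4].
have tE i x : (i < 5)%N -> (t`_i x : R) = e i x.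
  by case: i => [|[|[|[|[|]]]]] // _; rewrite /= ?h0E ?h1E ?h2E ?h3E ?h4E.
exists t => //; rewrite basisEfree; apply/and3P; split; last 2 first.
- exact: subvf.
- have -> : \dim {:'Hom(V, R^o)} = dim V by rewrite dimvf -[RHS]muln1.
  by rewrite -dimvf dV.
apply/(@freeP _ _ _ t) => k /lfunP k0 i.
have := k0 (E i); rewrite sum_lfunE zero_lfunE (bigD1 i) //= big1 => [|j ji].
  rewrite scale_lfunE (tE _ _ (ltn_ord i)) (frame_dual Ee) // eqxx addr0.
  by rewrite /GRing.scale /= mulr1.
rewrite scale_lfunE (tE _ _ (ltn_ord j)) (frame_dual Ee) // val_eqE.
by rewrite (negPf ji) scaler0.
Qed.

End Coframes.

(** * Hypo-contact frames *)

Ltac expand_sums := rewrite !(big_ord_recr, big_ord0) /= !add0r.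

Section HypoFrames.
Variables (R : realType) (V : vectType R).
Implicit Types (E : nat -> V) (e : nat -> V -> R).

Definition w1 e X Y := wedge11 (e 0%N) (e 1%N) X Y + wedge11 (e 2%N) (e 3%N) X Y.
Definition w2 e X Y := wedge11 (e 0%N) (e 2%N) X Y + wedge11 (e 3%N) (e 1%N) X Y.
Definition w3 e X Y := wedge11 (e 0%N) (e 3%N) X Y + wedge11 (e 1%N) (e 2%N) X Y.

Definition metric e X Y := \sum_(i < 5) e i X * e i Y.

Record hypo_frame (L : lieAlgebra V) E e : Prop := HypoFrame {
  hypo_frameP : frame E e;
  hypo_eta : forall X Y, e 4%N (L X Y) = 2 * w3 e X Y;
  hypo_w1 : forall X Y Z T, d3 L (wedge12 (e 4%N) (w1 e)) X Y Z T = 0;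
  hypo_w2 : forall X Y Z T, d3 L (wedge12 (e 4%N) (w2 e)) X Y Z T = 0
}.

(* Right linearity is not part of [lieAlgebra].  With
   f(x, y, z) = w3(x, [y, z]), linear in x and y, the eta-component of the
   Jacobi identity reads f(x, y, z) = - f(y, z, x) - f(z, x, y), and the right
   hand side is linear in z. *)
Lemma hypo_bracket_linear_r (L : lieAlgebra V) E e :
  hypo_frame L E e -> forall x, linear (L x).
Proof.
case=> Ee eta _ _.
have fJ x y z : w3 e x (L y z) = - w3 e y (L z x) - w3 e z (L x y).
  have /(congr1 (e 4%N)) := bracket_jacobi L x y z.
  by rewrite !(frameD Ee) (frame0 Ee) !eta; lra.
have wDr x a y z : w3 e x (a *: y + z) = a * w3 e x y + w3 e x z.
  by rewrite /w3 /wedge11 !(frameE Ee); ring.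
have wDl x a y z : w3 e (a *: y + z) x = a * w3 e y x + w3 e z x.
  by rewrite /w3 /wedge11 !(frameE Ee); ring.
move=> y a z t; apply: (frame_inj Ee) => i i5.
have f0 x : w3 e x (L y (a *: z + t)) = w3 e x (a *: L y z + L y t).
  rewrite wDr fJ (fJ x y z) (fJ x y t) !bracketDl !bracketZl !wDr !wDl; ring.
(* [w3] is nondegenerate on the kernel of eta, so pairing with the first four frame vectors recovers
   the first four coordinates; [eta] gives the last one. *)
have := (f0 (E 0%N), f0 (E 1%N), f0 (E 2%N), f0 (E 3%N)).
rewrite /w3 /wedge11 !(frame_dual Ee) //= !(mul0r, mul1r, mulr0, subr0, addr0, add0r).
move=> [[[h0 h1] h2] h3].
case: i i5 => [|[|[|[|[|]]]]] // _; first [lra | rewrite (frameD Ee) (frameZ Ee) !eta wDr; ring].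
Qed.

Section Change.
Variables (m : nat -> nat -> R).
Hypothesis mmT : forall i k, (i < 5)%N -> (k < 5)%N ->
  \sum_(j < 5) m i j * m k j = (i == k)%:R.

Definition change_frame E i := \sum_(j < 5) m i j *: E j.
Definition change_coframe e i X := \sum_(j < 5) m i j * e j X.

(** A one-sided inverse of a square matrix is two-sided. Orthogonality of the columns is what the
    span property and the invariance of the metric rest on. *)
Lemma orthogonalT j k : (j < 5)%N -> (k < 5)%N ->
  \sum_(i < 5) m i j * m i k = (j == k)%:R.
Proof.
move=> j5 k5; pose M : 'M[R]_5 := \matrix_(i, l) m i l.
have : M *m M^T = 1%:M.
  apply/matrixP => a c; rewrite !mxE -val_eqE -(mmT (ltn_ord a) (ltn_ord c)).
  by apply: eq_bigr => l _; rewrite !mxE.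
move/mulmx1C/matrixP/(_ (Ordinal j5) (Ordinal k5)); rewrite !mxE => <-.
by apply: eq_bigr => i _; rewrite !mxE.
Qed.

Lemma change_frameP E e : frame E e -> frame (change_frame E) (change_coframe e).
Proof.
move=> Ee; split.
- move=> i a x y; rewrite /change_coframe mulr_sumr -big_split; apply: eq_bigr.
  by move=> j _; rewrite !(frameE Ee) /=; ring.
- move=> i k i5 k5; rewrite -mmT // /change_coframe; apply: eq_bigr => j _.
  rewrite /change_frame (frame_sum Ee) (bigD1 j) //= big1 => [|l lj].
    by rewrite (frameZ Ee) (frame_dual Ee) // eqxx mulr1 addr0.
  by rewrite (frameZ Ee) (frame_dual Ee) // val_eqE eq_sym (negPf lj) mulr0.
move=> x; rewrite {1}(frame_span Ee x).
under [RHS]eq_bigr => i _.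
  rewrite /change_frame scaler_sumr; under eq_bigr => k _ do rewrite scalerA.
  over.
rewrite exchange_big /=; apply: eq_bigr => k _.
rewrite -scaler_suml; congr (_ *: _); rewrite /change_coframe.
under eq_bigr => i _ do rewrite mulr_suml.
rewrite exchange_big /=.
transitivity (\sum_(j < 5) e j x * (j == k :> nat)%:R); last first.
  apply: eq_bigr => j _; rewrite -(orthogonalT (ltn_ord j) (ltn_ord k)) mulr_sumr.
  by apply: eq_bigr => i _; ring.
rewrite (bigD1 k) //= eqxx mulr1 big1 ?addr0 // => j jk.
by rewrite val_eqE (negPf jk) mulr0.
Qed.

Lemma change_metric e X Y : metric (change_coframe e) X Y = metric e X Y.
Proof.
rewrite /metric /change_coframe.
under eq_bigr => i _ do rewrite big_distrlr /=.
rewrite exchange_big /=; apply: eq_bigr => j _.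
rewrite exchange_big /= (bigD1 j) //=.
have dE (k : 'I_5) : \sum_(i < 5) m i j * e j X * (m i k * e k Y)
    = (j == k :> nat)%:R * (e j X * e k Y).
  rewrite -(orthogonalT (ltn_ord j) (ltn_ord k)) mulr_suml.
  by apply: eq_bigr => i _; ring.
rewrite dE eqxx mul1r big1 ?addr0 // => k kj.
by rewrite dE val_eqE eq_sym (negPf kj) mul0r.
Qed.

End Change.
End HypoFrames.

(** * Changes of adapted coframe, and closed 1-forms from solvability *)

Section Gauge.
Variables (R : realType) (V : vectType R) (L : lieAlgebra V).
Implicit Types (E : nat -> V) (e : nat -> V -> R).

(** The closedness conditions are linear in the pair ([w1], [w2]), so they survive a rotation of
    this pair that keeps eta and [w3]. *)
Lemma change_hypo_frame (m : nat -> nat -> R) (s t : R) E e :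
  (forall i k, (i < 5)%N -> (k < 5)%N ->
     \sum_(j < 5) m i j * m k j = (i == k)%:R) ->
  let e' := change_coframe m e in
  (forall X, e' 4%N X = e 4%N X) ->
  (forall X Y, w1 e' X Y = s * w1 e X Y + t * w2 e X Y) ->
  (forall X Y, w2 e' X Y = s * w2 e X Y - t * w1 e X Y) ->
  (forall X Y, w3 e' X Y = w3 e X Y) ->
  hypo_frame L E e -> hypo_frame L (change_frame m E) e'.
Proof.
move=> mmT e' e4 e1 e2 e3 [Ee eta h1 h2]; split.
- exact: change_frameP.
- by move=> X Y; rewrite e4 e3 eta.
- move=> X Y Z T.
  transitivity (s * d3 L (wedge12 (e 4%N) (w1 e)) X Y Z T
     + t * d3 L (wedge12 (e 4%N) (w2 e)) X Y Z T); last by rewrite h1 h2; ring.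
  by rewrite /d3 /wedge12 !e4 !e1; ring.
- move=> X Y Z T.
  transitivity (s * d3 L (wedge12 (e 4%N) (w2 e)) X Y Z T
     - t * d3 L (wedge12 (e 4%N) (w1 e)) X Y Z T); last by rewrite h1 h2; ring.
  by rewrite /d3 /wedge12 !e4 !e2; ring.
Qed.

(* Row i holds u (a + b i + c j + d k), with u the i-th of the units 1, i, j, k:
   right multiplications commute with the left multiplications that define the
   three forms. *)
Definition quat_mx (a b c d : R) i j : R :=
  nth 0 (nth [::] [:: [:: a; b; c; d; 0]; [:: - b; a; - d; c; 0];
    [:: - c; d; a; - b; 0]; [:: - d; - c; b; a; 0]; [:: 0; 0; 0; 0; 1]] i) j.

(** Conjugation by a unit quaternion in the plane of 1 and k: it fixes e_0, hence an already
    normalised closed form, keeps [w3] and rotates the pair ([w1], [w2]). *)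
Definition rot_mx (s t : R) i j : R :=
  nth 0 (nth [::] [:: [:: 1; 0; 0; 0; 0]; [:: 0; s; t; 0; 0];
    [:: 0; - t; s; 0; 0]; [:: 0; 0; 0; 1; 0]; [:: 0; 0; 0; 0; 1]] i) j.

Lemma quat_mx_orthogonal a b c d : a ^+ 2 + b ^+ 2 + c ^+ 2 + d ^+ 2 = 1 ->
  forall i k, (i < 5)%N -> (k < 5)%N ->
  \sum_(j < 5) quat_mx a b c d i j * quat_mx a b c d k j = (i == k)%:R.
Proof.
move=> n1 i k; expand_sums; rewrite /quat_mx.
by case: i => [|[|[|[|[|]]]]] // _; case: k => [|[|[|[|[|]]]]] // _ /=; lra.
Qed.

Lemma rot_mx_orthogonal s t : s ^+ 2 + t ^+ 2 = 1 ->
  forall i k, (i < 5)%N -> (k < 5)%N ->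
  \sum_(j < 5) rot_mx s t i j * rot_mx s t k j = (i == k)%:R.
Proof.
move=> n1 i k; expand_sums; rewrite /rot_mx.
by case: i => [|[|[|[|[|]]]]] // _; case: k => [|[|[|[|[|]]]]] // _ /=; lra.
Qed.

Lemma quat_hypo_frame a b c d E e : a ^+ 2 + b ^+ 2 + c ^+ 2 + d ^+ 2 = 1 ->
  hypo_frame L E e ->
  hypo_frame L (change_frame (quat_mx a b c d) E)
    (change_coframe (quat_mx a b c d) e).
Proof.
move=> n1; apply: (@change_hypo_frame _ 1 0).
- exact: quat_mx_orthogonal.
- by move=> X; rewrite /change_coframe; expand_sums; rewrite /quat_mx /=; ring.
(* A right multiplication scales the three forms by the squared norm; writing the factor 1 as that
   norm leaves a polynomial identity. *)
- move=> X Y; rewrite mul1r mul0r addr0 -[RHS]mul1r -n1.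
  by rewrite /w1 /wedge11 /change_coframe; expand_sums; rewrite /quat_mx /=; ring.
- move=> X Y; rewrite mul1r mul0r subr0 -[RHS]mul1r -n1.
  by rewrite /w2 /wedge11 /change_coframe; expand_sums; rewrite /quat_mx /=; ring.
- move=> X Y; rewrite -[RHS]mul1r -n1.
  by rewrite /w3 /wedge11 /change_coframe; expand_sums; rewrite /quat_mx /=; ring.
Qed.

Lemma rot_hypo_frame s t E e : s ^+ 2 + t ^+ 2 = 1 -> hypo_frame L E e ->
  hypo_frame L (change_frame (rot_mx s t) E) (change_coframe (rot_mx s t) e).
Proof.
move=> n1; apply: (@change_hypo_frame _ s t).
- exact: rot_mx_orthogonal.
- by move=> X; rewrite /change_coframe; expand_sums; rewrite /rot_mx /=; ring.
- by move=> X Y; rewrite /w1 /w2 /wedge11 /change_coframe; expand_sums; rewrite /rot_mx /=; ring.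
- by move=> X Y; rewrite /w1 /w2 /wedge11 /change_coframe; expand_sums; rewrite /rot_mx /=; ring.
- move=> X Y; rewrite /w3 /wedge11 /change_coframe; expand_sums; rewrite /rot_mx /=.
  transitivity (wedge11 (e 0%N) (e 3%N) X Y
    + (s ^+ 2 + t ^+ 2) * wedge11 (e 1%N) (e 2%N) X Y).
    by rewrite /wedge11; ring.
  by rewrite n1 mul1r.
Qed.

Lemma change_coframe4 (m : nat -> nat -> R) e X :
  m 4%N 0%N = 0 -> m 4%N 1%N = 0 -> m 4%N 2%N = 0 -> m 4%N 3%N = 0 ->
  m 4%N 4%N = 1 -> change_coframe m e 4 X = e 4%N X.
Proof.
move=> h0 h1 h2 h3 h4; rewrite /change_coframe; expand_sums.
by rewrite h0 h1 h2 h3 h4; ring.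
Qed.

Lemma derived_series_const n :
  bracketv L fullv fullv = fullv -> derived_series L n = fullv.
Proof. by move=> H; elim: n => //= n; rewrite /derived_series /= => ->. Qed.

Lemma memv_bracketv (U : {vspace V}) x y : (forall x, linear (L x)) ->
  x \in U -> y \in U -> L x y \in bracketv L U U.
Proof.
move=> Lr xU yU; rewrite (coord_vbasis xU) (coord_vbasis yU) bracket_suml.
apply: memv_suml => i _; rewrite bracketZl (bracket_sumr Lr) memvZ //.
apply: memv_suml => j _; rewrite (bracketZr Lr) memvZ // memv_span //.
by apply/allpairsP; exists ((vbasis U)`_i, (vbasis U)`_j); rewrite !mem_nth ?size_tuple.
Qed.

(** A solvable nonzero algebra differs from its derived algebra, and a linear form is closed exactly
    when it vanishes on the latter. *)
Lemma solvable_closed_form : \dim {:V} = 5%N -> (forall x, linear (L x)) ->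
  lie_solvable L ->
  exists2 a : V -> R, scalar a &
    (exists x, a x != 0) /\ forall x y, a (L x y) = 0.
Proof.
move=> dV Lr [n Dn].
have [DV|DV] := eqVneq (bracketv L fullv fullv) fullv.
  by have := derived_series_const n DV; rewrite Dn => /(congr1 (fun U => \dim U));
    rewrite dimv0 dV.
set U := bracketv L fullv fullv in DV.
have /subvPn[v _ vU] : ~~ (fullv <= U)%VS.
  by apply: contra DV => H; rewrite eqEsubv subvf.
(* [phi] kills the derived algebra [U] but not [v]; some coordinate of [phi] is the required
   form. *)
pose phi x := x - projv U x.
have phiv : phi v != 0.
  by apply: contra vU; rewrite subr_eq0 => /eqP ->; rewrite memv_proj.
pose b := vbasis {:V}.
have [i bi] : exists i, coord b i (phi v) != 0.
  apply/existsP; apply: contraR phiv; rewrite negb_exists => /forallP H.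
  rewrite (coord_vbasis (memvf (phi v))) big1 // => i _.
  by have := H i; rewrite negbK => /eqP ->; rewrite scale0r.
exists (fun x => coord b i (phi x)).
  by move=> a x y; rewrite -linearP; congr (coord _ _ _);
     rewrite /phi linearP scalerBr opprD addrACA.
split; first by exists v.
move=> x y; rewrite /phi projv_id ?subrr ?linear0 //.
exact: memv_bracketv (memvf _) (memvf _).
Qed.

End Gauge.

(** * Normal form of the structure constants *)

Section NormalForm.
Variable R : realType.

(* [table a i j k] is the e_k-coordinate of [e_i, e_j], with 0-based indices.
   Here A(e_0) = (0, 0, 0, 2 b), A(e_1) = (0, p, u + b, v),
   A(e_2) = (0, u - b, q, w), A(e_3) = (0, v, w, r), and D e_0 = (0, x, y, z),
   D e_1 = (0, a, c, y), D e_2 = (0, d, - a, - x), D e_3 = 0. *)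
Record params := Params {
  pp : R; pq : R; pr : R; pu : R; pv : R; pw : R; pb : R;
  dx : R; dy : R; dz : R; da : R; dc : R; dd : R }.

Definition upper_table (a : params) (i j : nat) : seq R :=
  let: Params p q r u v w b x y z a c d := a in
  match i, j with
  | 0, 1 => [:: 0; - p; - (3 * b) - u; - v; 0]
  | 0, 2 => [:: 0; 3 * b - u; - q; - w; 0]
  | 0, 3 => [:: - (2 * b); - v; - w; - r; 2]
  | 1, 2 => [:: - (2 * b); v; w; - p - q; 2]
  | 1, 3 => [:: 0; - b - u; p + r; - w; 0]
  | 2, 3 => [:: 0; - q - r; u - b; v; 0]
  | 0, 4 => [:: 0; - x; - y; - z; 0]
  | 1, 4 => [:: 0; - a; - c; - y; 0]
  | 2, 4 => [:: 0; - d; a; x; 0]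
  | _, _ => [:: 0; 0; 0; 0; 0]
  end.

(** On the diagonal [upper_table] falls through to its zero row, so the second branch serves there
    too. *)
Definition table (a : params) (i j k : nat) : R :=
  if (i < j)%N then nth 0 (upper_table a i j) k else - nth 0 (upper_table a j i) k.

Variables (V : vectType R) (L : lieAlgebra V) (E : nat -> V) (e : nat -> V -> R).
Hypothesis hyp : hypo_frame L E e.
Let Ee := hypo_frameP hyp.
Let Lr := hypo_bracket_linear_r hyp.
Let c := sconst L E e.

(** Every condition is linear in the structure constants. The closed form fixes the coordinate 0,
    [hypo_eta] the coordinate 4, and the closedness of the three forms ties the rest to the entries
    recorded in [params]. *)
Lemma hypo_normal_form b :
  (forall x y, e 0%N (L x y) + b * e 4%N (L x y) = 0) ->
  exists a : params,
    forall i j k, (i < 5)%N -> (j < 5)%N -> (k < 5)%N -> c i j k = table a i j k.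
Proof.
move=> closed.
have cC i j k : c i j k = - c j i k by exact: sconstC.
have cD i k : c i i k = 0 by exact: sconst_diag.
have c4 i j : (i < 5)%N -> (j < 5)%N -> c i j 4 =
    2 * (((i == 0) && (j == 3))%N%:R - ((i == 3) && (j == 0))%N%:R
       + ((i == 1) && (j == 2))%N%:R - ((i == 2) && (j == 1))%N%:R).
  move=> i5 j5; rewrite /c /sconst (hypo_eta hyp) /w3 /wedge11 !(frame_dual Ee) //.
  by case: i i5 => [|[|[|[|[|]]]]] // _; case: j j5 => [|[|[|[|[|]]]]] // _ /=; ring.
have c0 i j : (i < 5)%N -> (j < 5)%N -> c i j 0 = - b * c i j 4.
  by move=> i5 j5; have := closed (E i) (E j); rewrite /c /sconst; lra.
(* With [E 4] as last argument, d(eta /\ w) reduces up to sign to dw on three vectors of H, because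
   neither w nor d eta sees [E 4]. *)
have h1 i j k := hypo_w1 hyp (E i) (E j) (E k) (E 4).
have h2 i j k := hypo_w2 hyp (E i) (E j) (E k) (E 4).
(* Closedness of [w3], obtained as the eta-component of the Jacobi identity. *)
have h3 i j k : w3 e (E i) (L (E j) (E k)) + w3 e (E j) (L (E k) (E i))
    + w3 e (E k) (L (E i) (E j)) = 0.
  have := congr1 (e 4%N) (bracket_jacobi L (E i) (E j) (E k)).
  by rewrite !(frameD Ee) (frame0 Ee) !(hypo_eta hyp); lra.
have e121 : c 1 2 1 = - c 0 1 3.
  have := h1 0%N 1%N 2%N; rewrite /d3 /wedge12 /w1 /w2 /wedge11 !(frame_dual Ee) //=.
  rewrite -!/(sconst _ _ _ _ _ _) -/c !c0 // !c4 //=; lra.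
have e131 : c 1 3 1 = c 0 1 2 + 2 * b.
  have := h1 0%N 1%N 3%N; rewrite /d3 /wedge12 /w1 /w2 /wedge11 !(frame_dual Ee) //=.
  rewrite -!/(sconst _ _ _ _ _ _) -/c !c0 // !c4 //=; lra.
have e231 : c 2 3 1 = c 0 2 2 + c 0 3 3.
  have := h1 0%N 2%N 3%N; rewrite /d3 /wedge12 /w1 /w2 /wedge11 !(frame_dual Ee) //=.
  rewrite -!/(sconst _ _ _ _ _ _) -/c !c0 // !c4 //=; lra.
have e133 : c 1 3 3 = - c 1 2 2.
  have := h1 1%N 2%N 3%N; rewrite /d3 /wedge12 /w1 /w2 /wedge11 !(frame_dual Ee) //=.
  rewrite -!/(sconst _ _ _ _ _ _) -/c !c0 // !c4 //=; lra.
have e122 : c 1 2 2 = - c 0 2 3.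
  have := h2 0%N 1%N 2%N; rewrite /d3 /wedge12 /w1 /w2 /wedge11 !(frame_dual Ee) //=.
  rewrite -!/(sconst _ _ _ _ _ _) -/c !c0 // !c4 //=; lra.
have e132 : c 1 3 2 = - c 0 1 1 - c 0 3 3.
  have := h2 0%N 1%N 3%N; rewrite /d3 /wedge12 /w1 /w2 /wedge11 !(frame_dual Ee) //=.
  rewrite -!/(sconst _ _ _ _ _ _) -/c !c0 // !c4 //=; lra.
have e232 : c 2 3 2 = - c 0 2 1 + 2 * b.
  have := h2 0%N 2%N 3%N; rewrite /d3 /wedge12 /w1 /w2 /wedge11 !(frame_dual Ee) //=.
  rewrite -!/(sconst _ _ _ _ _ _) -/c !c0 // !c4 //=; lra.
have e233 : c 2 3 3 = c 1 2 1.
  have := h2 1%N 2%N 3%N; rewrite /d3 /wedge12 /w1 /w2 /wedge11 !(frame_dual Ee) //=.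
  rewrite -!/(sconst _ _ _ _ _ _) -/c !c0 // !c4 //=; lra.
have e123 : c 1 2 3 = c 0 1 1 + c 0 2 2.
  have := h3 0%N 1%N 2%N; rewrite /w3 /wedge11 !(frame_dual Ee) //=.
  rewrite -!/(sconst _ _ _ _ _ _) -/c !(cC 2 0) !c0 // !c4 //=; lra.
have f133 : c 1 3 3 = c 0 3 2.
  have := h3 0%N 1%N 3%N; rewrite /w3 /wedge11 !(frame_dual Ee) //=.
  rewrite -!/(sconst _ _ _ _ _ _) -/c !(cC 3 0) !c0 // !c4 //=; lra.
have f233 : c 2 3 3 = - c 0 3 1.
  have := h3 0%N 2%N 3%N; rewrite /w3 /wedge11 !(frame_dual Ee) //=.
  rewrite -!/(sconst _ _ _ _ _ _) -/c !(cC 3 0) !c0 // !c4 //=; lra.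
have e012 : c 1 3 1 + c 2 3 2 = - 2 * b.
  have := h3 1%N 2%N 3%N; rewrite /w3 /wedge11 !(frame_dual Ee) //=.
  rewrite -!/(sconst _ _ _ _ _ _) -/c !(cC 3 1) !c0 // !c4 //=; lra.
have e143 : c 1 4 3 = c 0 4 2.
  have := h3 0%N 1%N 4%N; rewrite /w3 /wedge11 !(frame_dual Ee) //=.
  rewrite -!/(sconst _ _ _ _ _ _) -/c !(cC 4 0) !c0 // !c4 //=; lra.
have e243 : c 2 4 3 = - c 0 4 1.
  have := h3 0%N 2%N 4%N; rewrite /w3 /wedge11 !(frame_dual Ee) //=.
  rewrite -!/(sconst _ _ _ _ _ _) -/c !(cC 4 0) !c0 // !c4 //=; lra.
have e343 : c 3 4 3 = 0.
  have := h3 0%N 3%N 4%N; rewrite /w3 /wedge11 !(frame_dual Ee) //=.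
  rewrite -!/(sconst _ _ _ _ _ _) -/c !(cC 4 0) !c0 // !c4 //=; lra.
have e242 : c 2 4 2 = - c 1 4 1.
  have := h3 1%N 2%N 4%N; rewrite /w3 /wedge11 !(frame_dual Ee) //=.
  rewrite -!/(sconst _ _ _ _ _ _) -/c !(cC 4 1) !c0 // !c4 //=; lra.
have e342 : c 3 4 2 = 0.
  have := h3 1%N 3%N 4%N; rewrite /w3 /wedge11 !(frame_dual Ee) //=.
  rewrite -!/(sconst _ _ _ _ _ _) -/c !(cC 4 1) !c0 // !c4 //=; lra.
have e341 : c 3 4 1 = 0.
  have := h3 2%N 3%N 4%N; rewrite /w3 /wedge11 !(frame_dual Ee) //=.
  rewrite -!/(sconst _ _ _ _ _ _) -/c !(cC 4 2) !c0 // !c4 //=; lra.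
(* The b-terms of [c 0 1 2] and [c 0 2 1] are opposite, so the mean of the two is - u. *)
exists (Params (- c 0 1 1) (- c 0 2 2) (- c 0 3 3) (- (c 0 1 2 + c 0 2 1) / 2) (- c 0 3 1)
  (- c 0 3 2) b (- c 0 4 1) (- c 0 4 2) (- c 0 4 3) (- c 1 4 1) (- c 1 4 2) (- c 2 4 1)).
move=> i j k i5 j5 k5.
wlog ij : i j i5 j5 / (i < j)%N.
  move=> H; have [ij|ji|<-] := ltngtP i j; first exact: H.
    by rewrite cC H // /table ji ltnNge (ltnW ji).
  rewrite cD /table ltnn {H}.
  by case: i i5 => [|[|[|[|[|]]]]] // _; case: k k5 => [|[|[|[|[|]]]]] // _ /=; rewrite oppr0.
rewrite /table ij.
have [->|k0] := eqVneq k 0%N; last have [->|k4] := eqVneq k 4%N.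
- rewrite c0 // c4 //; case: j j5 ij => [|[|[|[|[|]]]]] // _;
  case: i i5 => [|[|[|[|[|]]]]] // _ _ /=; lra.
- rewrite c4 //; case: j j5 ij => [|[|[|[|[|]]]]] // _;
  case: i i5 => [|[|[|[|[|]]]]] // _ _ /=; lra.
case: j j5 ij => [|[|[|[|[|]]]]] // _; case: i i5 => [|[|[|[|[|]]]]] // _ _;
case: k k5 k0 k4 => [|[|[|[|[|]]]]] // _ _ _ /=; lra.
Qed.
End NormalForm.

(** * Normalisation of the frame by quaternions and rotations *)

Section NormalFrame.
Variables (R : realType).

Lemma unit_pair (x y : R) : x != 0 \/ y != 0 ->
  exists n s t : R, [/\ 0 < n, s ^+ 2 + t ^+ 2 = 1, x = n * s & y = n * t].
Proof.
move=> xy; have n0 : 0 < x ^+ 2 + y ^+ 2.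
  by case: xy => h; [apply: ltr_pwDl|apply: ltr_wpDl];
     rewrite ?sqr_ge0 // lt_def sqrf_eq0 h sqr_ge0.
set n := Num.sqrt (x ^+ 2 + y ^+ 2).
have n_gt0 : 0 < n by rewrite sqrtr_gt0.
have n_neq0 : n != 0 by rewrite gt_eqF.
have n2 : n ^+ 2 = x ^+ 2 + y ^+ 2 by rewrite sqr_sqrtr // ltW.
exists n, (x / n), (y / n); split=> //; try by rewrite mulrC divfK.
by rewrite !expr_div_n -mulrDl -n2 divff // expf_neq0.
Qed.

(** The equation says that the rotated symmetric matrix with diagonal p, q and off-diagonal entry u
    is diagonal. *)
Lemma diagonalizing_rotation (p q u : R) :
  exists s t : R, s ^+ 2 + t ^+ 2 = 1 /\ (s ^+ 2 - t ^+ 2) * u = s * t * (p - q).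
Proof.
have [->|u0] := eqVneq u 0.
  by exists 1, 0; rewrite expr1n expr0n /= addr0 !mulr0 mul0r.
(* [d] is the gap between the two eigenvalues, and (2 u, d - (p - q)) is an eigenvector for the
   larger one. *)
set d := Num.sqrt ((p - q) ^+ 2 + 4 * u ^+ 2).
have d2 : d ^+ 2 = (p - q) ^+ 2 + 4 * u ^+ 2.
  by rewrite sqr_sqrtr // addr_ge0 ?sqr_ge0 // mulr_ge0 ?sqr_ge0 // ler0n.
have [] := @unit_pair (2 * u) (d - (p - q)); first by left; rewrite mulf_neq0 // pnatr_eq0.
move=> n [s [t [n0 st hs ht]]]; exists s, t; split=> //.
have n2 : n ^+ 2 != 0 by rewrite expf_neq0 // gt_eqF.
apply: (mulfI n2).
transitivity (((n * s) ^+ 2 - (n * t) ^+ 2) * u); first by ring.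
transitivity ((n * s) * (n * t) * (p - q)); last by ring.
rewrite -hs -ht.
have : (d ^+ 2 - ((p - q) ^+ 2 + 4 * u ^+ 2)) * u = 0 by rewrite d2 subrr mul0r.
lra.
Qed.

Variables (V : vectType R) (L : lieAlgebra V) (dV : \dim {:V} = 5%N).
Implicit Types (E : nat -> V) (e : nat -> V -> R).

(** The closed form has a nonzero H-part: otherwise it is a multiple of eta, which must vanish as d
    eta is nonzero. A right multiplication turns the normalised H-part into the first coframe
    element. *)
Lemma closed_hypo_frame E e : lie_solvable L -> hypo_frame L E e ->
  exists E' e' b, [/\ hypo_frame L E' e',
    forall X Y, metric e' X Y = metric e X Y,
    forall X, e' 4%N X = e 4%N X &
    forall x y, e' 0%N (L x y) + b * e' 4%N (L x y) = 0].
Proof.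
move=> sol hyp; have Ee := hypo_frameP hyp.
have [f fs [[x0 fx0] fL]] := solvable_closed_form dV (hypo_bracket_linear_r hyp) sol.
have fD x y : f (x + y) = f x + f y by have := fs 1 x y; rewrite scale1r mul1r.
have f0 : f 0 = 0 by apply: (addIr (f 0)); rewrite -fD !add0r.
have fZ k x : f (k *: x) = k * f x by have := fs k x 0; rewrite f0 !addr0.
have fE x : f x = f (E 0%N) * e 0%N x + f (E 1%N) * e 1%N x
    + f (E 2%N) * e 2%N x + f (E 3%N) * e 3%N x + f (E 4%N) * e 4%N x.
  rewrite {1}(frame_span Ee x); expand_sums; rewrite !fD !fZ; ring.
set a0 := f (E 0%N) in fE; set a1 := f (E 1%N) in fE.
set a2 := f (E 2%N) in fE; set a3 := f (E 3%N) in fE.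
set a4 := f (E 4%N) in fE.
set N := a0 ^+ 2 + a1 ^+ 2 + a2 ^+ 2 + a3 ^+ 2.
have N_ge0 : 0 <= N by rewrite !addr_ge0 ?sqr_ge0.
have N0 : N != 0.
  apply: contra fx0 => /eqP N0.
  have sq0 (y : R) : y ^+ 2 <= 0 -> y = 0.
    by move=> h; apply/eqP; rewrite -sqrf_eq0 eq_le h sqr_ge0.
  have := (sqr_ge0 a0, sqr_ge0 a1, sqr_ge0 a2, sqr_ge0 a3).
  rewrite /N in N0 => -[[[q0 q1] q2] q3].
  have z0 : a0 = 0 by apply: sq0; lra.
  have z1 : a1 = 0 by apply: sq0; lra.
  have z2 : a2 = 0 by apply: sq0; lra.
  have z3 : a3 = 0 by apply: sq0; lra.
  have := fL (E 0%N) (E 3%N).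
  rewrite fE z0 z1 z2 z3 (hypo_eta hyp) /w3 /wedge11 !(frame_dual Ee) //= => z4.
  by rewrite fE z0 z1 z2 z3; apply/eqP; (have -> : a4 = 0 by lra); ring.
set n := Num.sqrt N.
have n0 : n != 0 by rewrite sqrtr_eq0 -ltNge lt_def N0.
have n2 : n ^+ 2 = N by rewrite sqr_sqrtr.
have q1 : (a0 / n) ^+ 2 + (a1 / n) ^+ 2 + (a2 / n) ^+ 2 + (a3 / n) ^+ 2 = 1.
  by rewrite !expr_div_n -!mulrDl -/N n2 divff.
(* The first row of [m] is the normalised H-part of [f], so [f] is n times the sum of the new e_0
   and (a4 / n) e_4. *)
pose m := quat_mx (a0 / n) (a1 / n) (a2 / n) (a3 / n).
exists (change_frame m E), (change_coframe m e), (a4 / n).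
split; first exact: (quat_hypo_frame q1 hyp).
- by move=> X Y; apply: change_metric; apply: quat_mx_orthogonal.
- by move=> X; apply: change_coframe4.
move=> x y; rewrite change_coframe4 //; apply: (mulfI n0).
rewrite mulr0 -(fL x y) fE /change_coframe; expand_sums; rewrite /m /quat_mx /=.
by field.
Qed.

(** In the symmetric matrix of [A], the pair (v, w) rotates as a vector and is brought to w = 0. If
    it vanishes the rotation is still free and diagonalises the block p, q, u. *)
Lemma normal_hypo_frame E e : lie_solvable L -> hypo_frame L E e ->
  exists E' e' (a : params R), [/\ hypo_frame L E' e',
    forall X Y, metric e' X Y = metric e X Y,
    forall X, e' 4%N X = e 4%N X,
    forall i j k, (i < 5)%N -> (j < 5)%N -> (k < 5)%N ->
      sconst L E' e' i j k = table a i j k &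
    pw a = 0 /\ (pv a = 0 -> pu a = 0)].
Proof.
move=> sol /(closed_hypo_frame sol)[{}E [{}e' [b [hyp gE e4 closed]]]].
have [a aE] := hypo_normal_form hyp closed.
have Ee := hypo_frameP hyp; have Lr := hypo_bracket_linear_r hyp.
have [s [t [st hw hv]]] : exists s t, [/\ s ^+ 2 + t ^+ 2 = 1,
    s * pw a - t * pv a = 0 &
    (s * pv a + t * pw a = 0 -> (s ^+ 2 - t ^+ 2) * pu a = s * t * (pp a - pq a))].
  have [/andP[/eqP v0 /eqP w0]|] := boolP ((pv a == 0) && (pw a == 0)).
    have [s [t [st h]]] := diagonalizing_rotation (pp a) (pq a) (pu a).
    by exists s, t; split=> //; rewrite v0 w0 !mulr0 subr0.
  rewrite negb_and => /orP/unit_pair[n [s [t [n0 st -> ->]]]].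
  exists s, t; split=> //; first by ring.
  move=> h; have : n * (s ^+ 2 + t ^+ 2) = 0 by rewrite -h; ring.
  by rewrite st mulr1 => /eqP; rewrite gt_eqF.
have hyp' := rot_hypo_frame st hyp.
have closed' x y : change_coframe (rot_mx s t) e' 0 (L x y)
    + b * change_coframe (rot_mx s t) e' 4 (L x y) = 0.
  rewrite change_coframe4 // -(closed x y) /change_coframe; expand_sums.
  by rewrite /rot_mx /=; ring.
(* The rotation fixes e_0 and e_4, so the normal form applies again with the same [b]; the new u, v,
   w are read off four entries. *)
have [a' aE'] := hypo_normal_form hyp' closed'.
exists (change_frame (rot_mx s t) E), (change_coframe (rot_mx s t) e'), a'.
split; first exact: hyp'.
- by move=> X Y; rewrite -gE; apply: change_metric; apply: rot_mx_orthogonal.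
- by move=> X; rewrite -e4; apply: change_coframe4.
- exact: aE'.
have E0 : change_frame (rot_mx s t) E 0 = E 0%N.
  by rewrite /change_frame; expand_sums; rewrite /rot_mx /= !scale0r scale1r !addr0.
have E3 : change_frame (rot_mx s t) E 3 = E 3%N.
  by rewrite /change_frame; expand_sums; rewrite /rot_mx /= !scale0r scale1r addr0 !add0r.
have E1 : change_frame (rot_mx s t) E 1 = s *: E 1%N + t *: E 2%N.
  by rewrite /change_frame; expand_sums; rewrite /rot_mx /= !scale0r !addr0 add0r.
have E2 : change_frame (rot_mx s t) E 2 = - t *: E 1%N + s *: E 2%N.
  by rewrite /change_frame; expand_sums; rewrite /rot_mx /= !scale0r !addr0 add0r.
have e1 x : change_coframe (rot_mx s t) e' 1 x = s * e' 1%N x + t * e' 2%N x.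
  by rewrite /change_coframe; expand_sums; rewrite /rot_mx /= !mul0r !addr0 add0r.
have e2 x : change_coframe (rot_mx s t) e' 2 x = - t * e' 1%N x + s * e' 2%N x.
  by rewrite /change_coframe; expand_sums; rewrite /rot_mx /= !mul0r !addr0 add0r.
have c011 := aE 0%N 1%N 1%N isT isT isT; have c012 := aE 0%N 1%N 2%N isT isT isT.
have c021 := aE 0%N 2%N 1%N isT isT isT; have c022 := aE 0%N 2%N 2%N isT isT isT.
have c031 := aE 0%N 3%N 1%N isT isT isT; have c032 := aE 0%N 3%N 2%N isT isT isT.
have d012 := aE' 0%N 1%N 2%N isT isT isT; have d021 := aE' 0%N 2%N 1%N isT isT isT.
have d031 := aE' 0%N 3%N 1%N isT isT isT; have d032 := aE' 0%N 3%N 2%N isT isT isT.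
rewrite /sconst /table /= in c011 c012 c021 c022 c031 c032 d012 d021 d031 d032.
rewrite E0 ?E1 ?E2 ?E3 ?(bracketDr Lr) ?(bracketZr Lr) ?e1 ?e2 ?(frameE Ee)
  ?c011 ?c012 ?c021 ?c022 ?c031 ?c032 in d012 d021 d031 d032.
move: hw hv d012 d021 d031 d032.
case: (a) => p q r u v w b1 x y z a1 c1 d1.
case: (a') => p' q' r' u' v' w' b1' x' y' z' a1' c1' d1' /= hw hv d012 d021 d031 d032.
have w'0 : w' = 0 by lra.
split=> // v'0.
have : s * v + t * w = 0 by lra.
by move/hv; lra.
Qed.

End NormalFrame.

(** * Solutions of the Jacobi identity *)

Section Classification.
Variables (R : realType).

Definition jacobi_table (a : params R) := forall i j k l,
  (i < 5)%N -> (j < 5)%N -> (k < 5)%N -> (l < 5)%N ->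
  \sum_(m < 5) (table a j k m * table a i m l + table a k i m * table a j m l
    + table a i j m * table a k m l) = 0.

Ltac jac J i j k l := have := J i j k l isT isT isT isT; expand_sums;
  rewrite /table /=.

(** [D] rotates the plane of e_1 and e_2 with speed 3 (b^2 + p^2); the value p = b = 0 is the case A
    = 0. *)
Definition h3_params (p b : R) :=
  Params p p (2 * p) 0 0 0 b 0 0 0 0 (- (3 * (b ^+ 2 + p ^+ 2))) (3 * (b ^+ 2 + p ^+ 2)).

(** For nonzero [r] the vectors e_1, e_2, e_4 span a copy of sl(2, R). *)
Definition simple_params (r : R) :=
  Params 0 0 r 0 0 0 0 0 0 0 0 (- (r ^+ 2 / 2)) (r ^+ 2 / 2).

(** Instances on the first four vectors are linear in [D] and express it by quadratic polynomials;
    instances with e_4 then become cubic equations. A nonzero [b] can be divided out of them; for b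
    = 0 the sign of z decides. *)
Lemma jacobi_table_classification (a : params R) :
  jacobi_table a -> pw a = 0 -> (pv a = 0 -> pu a = 0) ->
  (dx a = 0 /\ dy a = 0 /\ dz a = 0 \/
   4 * dz a = dx a ^+ 2 + dy a ^+ 2 + dz a ^+ 2) ->
  (exists p b, a = h3_params p b) \/ (exists2 r, r != 0 & a = simple_params r).
Proof.
case: a => p q r u v w b x y z a c d J /= w0 v0u0 hyp; subst w.
have sq0 (t : R) : t ^+ 2 <= 0 -> t = 0.
  by move=> h; apply/eqP; rewrite -sqrf_eq0 eq_le h sqr_ge0.
have sq t : 0 <= t ^+ 2 :> R by exact: sqr_ge0.
jac J 0%N 1%N 2%N 1%N => e1; jac J 0%N 1%N 2%N 2%N => e2; jac J 0%N 1%N 2%N 3%N => e3.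
jac J 0%N 1%N 3%N 1%N => e4; jac J 0%N 1%N 3%N 2%N => e5; jac J 0%N 2%N 3%N 1%N => e6.
jac J 0%N 3%N 4%N 3%N => e7.
have [b0|b0] := eqVneq b 0; last first.
  jac J 1%N 2%N 3%N 1%N => e8; jac J 1%N 2%N 3%N 3%N => e9.
  have v0 : v = 0 by apply: (mulfI b0); lra.
  have u0 := v0u0 v0; subst v u.
  have r0 : r = p + q by apply: (mulfI b0); lra.
  have x0 : x = 0 by lra.
  have y0 : y = 0 by lra.
  have z0 : z = 0 by apply: (mulfI b0); lra.
  subst x y z r.
  have a0 : a = 2 * b * (q - p) by lra.
  have c0 : c = (- 6 * b ^+ 2 + p * q - 2 * p * (p + q) - p ^+ 2
    + q * (p + q) - (p + q) ^+ 2) / 2 by lra.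
  have d0 : d = (6 * b ^+ 2 - p * q - p * (p + q) + 2 * q * (p + q)
    + q ^+ 2 + (p + q) ^+ 2) / 2 by lra.
  subst a c d.
  jac J 0%N 1%N 4%N 1%N => f1; jac J 0%N 1%N 4%N 2%N => f2; jac J 1%N 3%N 4%N 2%N => f3.
  have {}f1 : (p - q) * (p + q) = 0 by apply: (mulfI b0); lra.
  (* The other factor, p + q = 0, forces b p^2 = 0, hence p = q = 0. *)
  have pq : p = q.
    apply/eqP; rewrite -subr_eq0; apply/negPn/negP => pq.
    have q0 : q = - p by have := mulfI pq (etrans f1 (esym (mulr0 _))); lra.
    subst q; move/eqP: pq; apply.
    have : b * p ^+ 2 = 0 by lra.
    by move/eqP; rewrite mulf_eq0 (negPf b0) sqrf_eq0 => /eqP ->; ring.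
  subst q; left; exists p, b; rewrite /h3_params; congr Params; by field.
subst b.
have y0 : y = - (u * v) by lra.
subst y.
(* For nonzero v the Jacobi identity yields v^2 u = 0; for v = 0 the normalisation applies. *)
have u0 : u = 0.
  have [/v0u0//|v0] := eqVneq v 0.
  by apply: (mulfI v0); apply: (mulfI v0); lra.
subst u.
have x0 : x = v * (p + 3 * q + r) / 2 by lra.
have z0 : z = (- (p + q) ^+ 2 + r * (p + q) - 2 * v ^+ 2) / 2 by lra.
have a0 : a = 0 by lra.
have c0 : c = (p * q - 2 * p * r - p ^+ 2 + q * r - r ^+ 2) / 2 by lra.
have d0 : d = (- p * q - p * r + 2 * q * r + q ^+ 2 + r ^+ 2 + 2 * v ^+ 2) / 2 by lra.
(* If z <= 0, then 4 z = x^2 + y^2 + z^2 equates a nonpositive number with a sum of squares. *)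
have {hyp} hyp : z <= 0 -> x = 0 /\ z = 0.
  case: hyp => [[-> [_ ->]]//|hyp] zle.
  by have := (sq x, sq z) => -[]; split; apply: sq0; lra.
subst x z a c d.
jac J 0%N 1%N 4%N 2%N => f1; jac J 0%N 2%N 4%N 1%N => f2.
jac J 0%N 2%N 4%N 3%N => f3; jac J 0%N 3%N 4%N 2%N => f4.
jac J 1%N 3%N 4%N 1%N => f5.
have {f1}g1 : (p + r) * (p * r - v ^+ 2 - 2 * p * q) = 0 by lra.
have {f2}g2 : q * (2 * p * r + 2 * p * q - r ^+ 2 - 3 * v ^+ 2 - q * r) = 0 by lra.
have {f3 f4}g3 : v * q ^+ 2 = 0 by lra.
have {f5}g5 : (p + r) * (v ^+ 2 - p * r + q ^+ 2 + q * (r - p)) = 0 by lra.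
clear e1 e2 e3 e4 e5 e6 e7 J v0u0.
(* The common exit of the branches with q = 0: [r] alone remains, and its vanishing decides between
   [h3_params 0 0] and [simple_params r]. *)
have conclude : p = 0 -> q = 0 -> v = 0 ->
    (exists p' b, Params p q r 0 v 0 0 (v * (p + 3 * q + r) / 2) (- (0 * v))
        ((- (p + q) ^+ 2 + r * (p + q) - 2 * v ^+ 2) / 2) 0
        ((p * q - 2 * p * r - p ^+ 2 + q * r - r ^+ 2) / 2)
        ((- p * q - p * r + 2 * q * r + q ^+ 2 + r ^+ 2 + 2 * v ^+ 2) / 2)
        = h3_params p' b) \/
    (exists2 r', r' != 0 & Params p q r 0 v 0 0 (v * (p + 3 * q + r) / 2) (- (0 * v))
        ((- (p + q) ^+ 2 + r * (p + q) - 2 * v ^+ 2) / 2) 0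
        ((p * q - 2 * p * r - p ^+ 2 + q * r - r ^+ 2) / 2)
        ((- p * q - p * r + 2 * q * r + q ^+ 2 + r ^+ 2 + 2 * v ^+ 2) / 2)
        = simple_params r').
  move=> -> -> ->; have [->|r0] := eqVneq r 0.
    by left; exists 0, 0; rewrite /h3_params; congr Params; field.
  by right; exists r => //; rewrite /simple_params; congr Params; field.
(* In every branch but the last, the cubic equations make z minus a sum of squares with positive
   coefficients. Hence z = 0 and these squares vanish, which leads to [conclude] or contradicts q !=
   0. *)
have [q0|q0] := eqVneq q 0.
  subst q; move/eqP: g1; rewrite mulf_eq0 => /orP[/eqP g1|/eqP g1].
    have r0 : r = - p by lra.
    subst r; have := (sq p, sq v) => -[p2 v2].
    have [|_ z0] := hyp; first by lra.
    by apply: conclude => //; apply: sq0; lra.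
  have := (sq p, sq v) => -[p2 v2].
  have [|_ z0] := hyp; first by lra.
  by apply: conclude => //; apply: sq0; lra.
have v0 : v = 0.
  by move/eqP: g3; rewrite mulf_eq0 sqrf_eq0 (negPf q0) orbF => /eqP.
subst v; move/eqP: g2; rewrite mulf_eq0 (negPf q0) /= => /eqP g2.
have [pr|pr] := eqVneq (p + r) 0.
  have r0 : r = - p by lra.
  subst r; have : p * (q - p) = 0 by lra.
  move/eqP; rewrite mulf_eq0 => /orP[/eqP p0|/eqP p0].
    subst p; have := sq q => q2.
    have [|_ z0] := hyp; first by lra.
    by case/negP: q0; apply/eqP/sq0; lra.
  have pq : p = q by lra.
  subst p; have := sq q => q2.
  have [|_ z0] := hyp; first by lra.
  by case/negP: q0; apply/eqP/sq0; lra.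
move/eqP: g1; rewrite mulf_eq0 (negPf pr) /= => /eqP g1.
move/eqP: g5; rewrite mulf_eq0 (negPf pr) /= => /eqP g5.
have q3 : q + r = 3 * p by apply: (mulfI q0); lra.
have r0 : r = 3 * p - q by lra.
subst r; have : p * (p - q) = 0 by lra.
move/eqP; rewrite mulf_eq0 => /orP[/eqP p0|/eqP p0].
  subst p; have := sq q => q2.
  have [|_ z0] := hyp; first by lra.
  by case/negP: q0; apply/eqP/sq0; lra.
have pq : p = q by lra.
subst p; left; exists q, 0.
by rewrite /h3_params; congr Params; field.
Qed.

End Classification.

(** * The Killing and eta-Einstein conditions in terms of [params] *)

Section MetricConditions.
Variables (R : realType) (V : vectType R) (L : lieAlgebra V).
Variables (E : nat -> V) (e : nat -> V -> R) (a : params R).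
Hypothesis (Ee : frame E e).
Hypothesis (Lr : forall x, linear (L x)).
Hypothesis (aE : forall i j k, (i < 5)%N -> (j < 5)%N -> (k < 5)%N ->
      sconst L E e i j k = table a i j k).

Lemma metric_frame x i : (i < 5)%N -> metric e x (E i) = e i x.
Proof.
move=> i5; rewrite /metric (bigD1 (Ordinal i5)) //= big1 => [|j ji].
  by rewrite (frame_dual Ee) // eqxx mulr1 addr0.
by rewrite (frame_dual Ee) // -[_ == i]/(j == Ordinal i5) (negPf ji) mulr0.
Qed.

Lemma metricC x y : metric e x y = metric e y x.
Proof. by apply: eq_bigr => i _; rewrite mulrC. Qed.

Lemma metric_dual xi : (forall x, metric e xi x = e 4%N x) -> xi = E 4%N.
Proof.
move=> h; apply: (frame_inj Ee) => i i5.
by rewrite -metric_frame // h !(frame_dual Ee) // eq_sym.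
Qed.

Lemma table_jacobi : jacobi_table a.
Proof.
move=> i j k l i5 j5 k5 l5; rewrite -[RHS](sconst_jacobi Ee Lr i j k l).
by apply: eq_bigr => m _; rewrite !aE.
Qed.

(** For a Killing [xi] the map [D] is skew. As no [D e_j] has an e_0-component, the components x, y,
    z of [D e_0] vanish. *)
Lemma killing_table xi : (forall x, metric e xi x = e 4%N x) ->
  killing L (metric e) xi -> dx a = 0 /\ dy a = 0 /\ dz a = 0.
Proof.
move/metric_dual=> -> K.
have K0 j : (j < 5)%N -> table a 4 0 j + table a 4 j 0 = 0.
  move=> j5; have := K (E 0%N) (E j).
  rewrite metric_frame // metricC metric_frame // -!/(sconst _ _ _ _ _ _) !aE //; lra.
have := (K0 1%N isT, K0 2%N isT, K0 3%N isT).
rewrite /table /=; case: (a) => p q r u v w b x y z a' c d /= [[h1 h2] h3].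
by split; [|split]; lra.
Qed.

Section LeviCivita.
Variable nabla : V -> V -> V.
Hypothesis LC : levi_civita L (metric e) nabla.

Let nDl y x z : nabla (x + z) y = nabla x y + nabla z y.
Proof. by case: LC => h _ _ _; have := h y 1 x z; rewrite !scale1r. Qed.
Let nDr y x z : nabla y (x + z) = nabla y x + nabla y z.
Proof. by case: LC => _ h _ _; have := h y 1 x z; rewrite !scale1r. Qed.
Let n0l y : nabla 0 y = 0.
Proof. by apply: (addIr (nabla 0 y)); rewrite -nDl !add0r. Qed.
Let n0r y : nabla y 0 = 0.
Proof. by apply: (addIr (nabla y 0)); rewrite -nDr !add0r. Qed.
Let nZl k y x : nabla (k *: x) y = k *: nabla x y.
Proof. by case: LC => h _ _ _; have := h y k x 0; rewrite n0l !addr0. Qed.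
Let nZr k y x : nabla y (k *: x) = k *: nabla y x.
Proof. by case: LC => _ h _ _; have := h y k x 0; rewrite n0r !addr0. Qed.

Let G i j k := e k (nabla (E i) (E j)).

(** Koszul's formula in an orthonormal left-invariant frame, solved from three torsion and three
    metric equations. *)
Lemma christoffelE i j k : (i < 5)%N -> (j < 5)%N -> (k < 5)%N ->
  G i j k = (table a i j k - table a j k i + table a k i j) / 2.
Proof.
move=> i5 j5 k5; case: LC => _ _ tors comp.
have T i' j' k' : (i' < 5)%N -> (j' < 5)%N -> (k' < 5)%N ->
    G i' j' k' - G j' i' k' = table a i' j' k'.
  move=> *; rewrite -aE // /sconst -tors (frameD Ee) (frameN Ee) //.
have C i' j' k' : (j' < 5)%N -> (k' < 5)%N -> G i' j' k' + G i' k' j' = 0.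
  move=> j5' k5'; have := comp (E i') (E j') (E k').
  by rewrite metric_frame // metricC metric_frame.
have := (T i j k i5 j5 k5, T j k i j5 k5 i5, T k i j k5 i5 j5).
have := (C i j k j5 k5, C j k i k5 i5, C k i j i5 j5).
move=> [[C1 C2] C3] [[T1 T2] T3]; lra.
Qed.

Lemma nabla_coordr i y k : e k (nabla (E i) y) = \sum_(m < 5) e m y * G i m k.
Proof.
rewrite {1}(frame_span Ee y) (big_morph _ (nDr (E i)) (n0r (E i))) (frame_sum Ee).
by apply: eq_bigr => m _; rewrite nZr (frameZ Ee).
Qed.

Lemma nabla_coordl x j k : e k (nabla x (E j)) = \sum_(m < 5) e m x * G m j k.
Proof.
rewrite {1}(frame_span Ee x).
rewrite (big_morph (nabla^~ (E j)) (fun u v => nDl (E j) u v) (n0l (E j))).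
by rewrite (frame_sum Ee); apply: eq_bigr => m _; rewrite nZl (frameZ Ee).
Qed.

Lemma ricci_frameE i : (i < 5)%N ->
  ricci L nabla (E i) (E i) = \sum_(z < 5) \sum_(m < 5)
    (G i i m * G z m z - G z i m * G i m z - table a z i m * G m i z).
Proof.
move=> i5; rewrite /ricci (traceE Ee); last first.
  move=> k x y; apply: (frame_inj Ee) => l _; rewrite /curvature.
  rewrite bracketDl bracketZl !(nDl, nZl, nDr, nZr) !(frameE Ee); ring.
apply: eq_bigr => z _; rewrite /curvature !(frameD Ee) !(frameN Ee).
rewrite !nabla_coordr nabla_coordl -!sumrN -!big_split; apply: eq_bigr => m _ /=.
by rewrite -[e m (L _ _)]/(sconst L E e z i m) aE.
Qed.

(** [E 0] and [E 3] are unit vectors orthogonal to [E 4], so the eta-Einstein condition gives them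
    the same Ricci curvature. *)
Lemma ricci_table :
  (exists tau nu : R, forall X Y,
     ricci L nabla X Y = tau * metric e X Y + nu * e 4%N X * e 4%N Y) ->
  4 * dz a = dx a ^+ 2 + dy a ^+ 2 + dz a ^+ 2.
Proof.
move=> [tau [nu H]].
have : ricci L nabla (E 0%N) (E 0%N) = ricci L nabla (E 3%N) (E 3%N).
  by rewrite !H !metric_frame // !(frame_dual Ee).
rewrite !ricci_frameE //.
(* This instance reads 2 z = r (p + q) - (p + q)^2 - 2 v^2 - 2 w^2; modulo it, the equality of the
   two Ricci curvatures is the claimed relation. *)
have J := table_jacobi (isT : 0 < 5)%N (isT : 1 < 5)%N (isT : 2 < 5)%N (isT : 3 < 5)%N.
move: J; expand_sums; rewrite !christoffelE // /table /=.
case: (a) => p q r u v w b x y z a' c d /=; lra.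
Qed.

End LeviCivita.
End MetricConditions.

(** * The models *)

Section Models.
Variable R : realType.

Let inord_eq (i j : nat) : (i < 5)%N -> (j < 5)%N ->
  (inord i == inord j :> 'I_5) = (i == j).
Proof. by move=> i5 j5; rewrite -val_eqE /= !inordK. Qed.

Lemma row5P (x y : 'rV[R]_5) :
  (forall i, (i < 5)%N -> x 0 (inord i) = y 0 (inord i)) -> x = y.
Proof.
by move=> h; apply/rowP => i; rewrite -(inord_val i); apply: h.
Qed.

Lemma h1_coordE (x y : 'rV[R]_5) k : (k < 5)%N ->
  h1_bracket x y 0 (inord k) = (k == 4)%N%:R * (minor x y 1 4 + minor x y 2 3).
Proof.
move=> k5; rewrite /h1_bracket.
case: k k5 => [|[|[|[|[|]]]]] // _; rewrite !(mxE, eqxx, inord_eq) //=; ring.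
Qed.

Lemma h3_coordE (x y : 'rV[R]_5) k : (k < 5)%N ->
  h3_bracket x y 0 (inord k) =
  nth 0 [:: 2 * minor x y 1 4 + minor x y 2 3; minor x y 2 4 + minor x y 3 5;
            minor x y 3 4 - minor x y 2 5; 0; 0] k.
Proof.
move=> k5; rewrite /h3_bracket.
case: k k5 => [|[|[|[|[|]]]]] // _; rewrite !(mxE, eqxx, inord_eq) //=; ring.
Qed.

Variables (V : vectType R) (L : lieAlgebra V) (dV : \dim {:V} = 5%N).

Section Direct.
Variables (E : nat -> V) (e : nat -> V -> R) (a : params R).
Hypothesis (Ee : frame E e).
Hypothesis (Lr : forall x, linear (L x)).
Hypothesis (aE : forall i j k, (i < 5)%N -> (j < 5)%N -> (k < 5)%N ->
      sconst L E e i j k = table a i j k).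

Lemma bracket_tableE k x y : (k < 5)%N ->
  e k (L x y) = \sum_(i < 5) \sum_(j < 5) e i x * (e j y * table a i j k).
Proof.
move=> k5; rewrite (bracket_coordE Ee Lr); apply: eq_bigr => i _.
by apply: eq_bigr => j _; rewrite aE.
Qed.

Lemma bracket_frame_tableE i j : (i < 5)%N -> (j < 5)%N ->
  L (E i) (E j) = \sum_(k < 5) table a i j k *: E k.
Proof.
move=> i5 j5; rewrite [LHS](frame_span Ee); apply: eq_bigr => k _.
by rewrite -aE.
Qed.

Lemma iso_of_row_coords (M : lieAlgebra 'rV[R]_5) (F : V -> nat -> R) :
  (forall i, (i < 5)%N -> scalar (F^~ i)) ->
  (forall x, (forall i, (i < 5)%N -> F x i = 0) -> x = 0) ->
  (forall x y, \row_(i < 5) F (L x y) i = M (\row_(i < 5) F x i) (\row_(i < 5) F y i)) ->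
  lie_isomorphic L M.
Proof.
move=> Fl F0 FM; have [||h [hb hE]] := @iso_of_coords R V 5 (fun x => \row_(i < 5) F x i) dV.
- by move=> k x y; apply/rowP => i; rewrite !mxE Fl.
- move=> x /rowP h; apply: F0 => i i5.
  by have := h (Ordinal i5); rewrite !mxE.
by exists h; split=> // x y; rewrite !hE.
Qed.

Lemma h1_iso : a = h3_params 0 0 -> lie_isomorphic L (h1 R).
Proof.
(* Halving e_4 absorbs the factor 2 in [e_0, e_3] = [e_1, e_2] = 2 e_4. *)
move=> aP; pose F x i := nth 0 [:: e 0%N x; e 1%N x; e 2%N x; e 3%N x; e 4%N x / 2] i.
apply: (@iso_of_row_coords _ F).
- move=> i i5 k x y; rewrite /F.
  by case: i i5 => [|[|[|[|[|]]]]] // _ /=; rewrite (frameD Ee) (frameZ Ee); ring.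
- move=> x h; apply: (frame_inj Ee) => i i5; rewrite (frame0 Ee).
  have := h i i5; rewrite /F; case: i i5 => [|[|[|[|[|]]]]] // _ /=; lra.
move=> x y; apply: row5P => k k5; rewrite [RHS]h1_coordE // /minor !mxE !inordK //.
rewrite /F; case: k k5 => [|[|[|[|[|]]]]] // _ /=;
rewrite bracket_tableE //; expand_sums; rewrite aP /table /=; by field.
Qed.

Lemma h3_iso p b : p != 0 \/ b != 0 -> a = h3_params p b -> lie_isomorphic L (h3 R).
Proof.
move=> pb aP; set n := b ^+ 2 + p ^+ 2.
have n0 : n != 0.
  by case: pb => h; rewrite gt_eqF //; [apply: ltr_wpDl|apply: ltr_pwDl];
     rewrite ?sqr_ge0 // lt_def sqrf_eq0 h sqr_ge0.
(* The last two coordinates of [h3] vanish on brackets, so they must be closed forms of [L]: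
   combinations of e^0 + b e^4 and e^3 + p e^4, in 0-based indices. The factor 3 n is the speed of
   the rotation [D]. *)
pose t x := - (b * e 0%N x + p * e 3%N x) / (2 * n).
pose F x i := nth 0 [:: t x; e 1%N x; e 2%N x; p * e 0%N x - b * e 3%N x;
  3 * n * (2 * t x - e 4%N x)] i.
apply: (@iso_of_row_coords _ F).
- move=> i i5 k x y; rewrite /F /t.
  by case: i i5 => [|[|[|[|[|]]]]] // _ /=; rewrite !(frameD Ee) !(frameZ Ee); field; rewrite ?n0.
- move=> x h; have := (h 0%N isT, h 1%N isT, h 2%N isT, h 3%N isT, h 4%N isT).
  rewrite /F /= => -[[[[h0 h1] h2] h3] h4].
  have {}h4 : e 4%N x = 0.
    have : 3 * n != 0 by rewrite mulf_neq0 // pnatr_eq0.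
    by move/mulfI => I3; have := I3 _ _ (etrans h4 (esym (mulr0 _))); rewrite h0; lra.
  have {}h0 : b * e 0%N x + p * e 3%N x = 0.
    have : (b * e 0%N x + p * e 3%N x) = t x * - (2 * n) by rewrite /t; field.
    by rewrite h0 mul0r.
  have {h0 h3}[h0 h3] : e 0%N x = 0 /\ e 3%N x = 0.
    split; apply: (mulfI n0); rewrite mulr0.
      transitivity (b * (b * e 0%N x + p * e 3%N x) + p * (p * e 0%N x - b * e 3%N x)).
        by rewrite /n; ring.
      by rewrite h0 h3; ring.
    transitivity (p * (b * e 0%N x + p * e 3%N x) - b * (p * e 0%N x - b * e 3%N x)).
      by rewrite /n; ring.
    by rewrite h0 h3; ring.
  apply: (frame_inj Ee) => i i5; rewrite (frame0 Ee).
  by case: i i5 => [|[|[|[|[|]]]]].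
move=> x y; apply: row5P => k k5; rewrite [RHS]h3_coordE // /minor !mxE !inordK //.
rewrite /F /t; case: k k5 => [|[|[|[|[|]]]]] // _ /=;
rewrite !bracket_tableE //; expand_sums; rewrite aP /table /= /n; field; rewrite ?[_ != 0]n0 //.
Qed.

(** e_1, e_2, e_4 are, up to nonzero factors, brackets of one another, so they lie in every term of
    the derived series. *)
Lemma simple_not_solvable r : r != 0 -> a = simple_params r -> ~ lie_solvable L.
Proof.
move=> r0 aP [n Dn].
have b12 : L (E 1%N) (E 2%N) = 2 *: E 4%N.
  rewrite bracket_frame_tableE //; expand_sums; rewrite aP /table /=.
  by rewrite !(mulr0, oppr0, addr0, scale0r, add0r).
have b14 : L (E 1%N) (E 4%N) = (r ^+ 2 / 2) *: E 2%N.
  rewrite bracket_frame_tableE //; expand_sums; rewrite aP /table /=.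
  by rewrite !(oppr0, opprK, addr0, scale0r, add0r).
have b24 : L (E 2%N) (E 4%N) = - (r ^+ 2 / 2) *: E 1%N.
  rewrite bracket_frame_tableE //; expand_sums; rewrite aP /table /=.
  by rewrite !(addr0, scale0r, add0r).
have s0 : r ^+ 2 / 2 != 0 by rewrite mulf_neq0 ?invr_eq0 ?pnatr_eq0 // expf_neq0.
have two0 : (2 : R) != 0 by rewrite pnatr_eq0.
have memZ c (U : {vspace V}) v : c != 0 -> c *: v \in U -> v \in U.
  by move=> c0 /(memvZ c^-1); rewrite scalerA mulVf // scale1r.
have [h _] : E 1%N \in derived_series L n /\
    (E 2%N \in derived_series L n /\ E 4%N \in derived_series L n).
  elim: (n) => [|m [h1 [h2 h4]]]; first by rewrite !memvf.
  have := (memv_bracketv Lr h1 h2, memv_bracketv Lr h1 h4, memv_bracketv Lr h2 h4).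
  rewrite b12 b14 b24 => -[[k1 k2] k3].
  split; [|split]; [apply: memZ k3|apply: memZ k2|apply: memZ k1] => //.
  by rewrite oppr_eq0.
move: h; rewrite Dn memv0 => /eqP h.
have := frame_dual Ee (isT : 1 < 5)%N (isT : 1 < 5)%N.
by rewrite h (frame0 Ee) => /esym/eqP; rewrite oner_eq0.
Qed.

End Direct.

Lemma iso_of_hypo_frame E e : lie_solvable L -> hypo_frame L E e ->
  ((exists2 xi, (forall x, metric e xi x = e 4%N x) & killing L (metric e) xi) \/
   (exists2 nabla, levi_civita L (metric e) nabla & exists tau nu : R,
      forall X Y, ricci L nabla X Y
        = tau * metric e X Y + nu * e 4%N X * e 4%N Y)) ->
  lie_isomorphic L (h1 R) \/ lie_isomorphic L (h3 R).
Proof.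
move=> sol hyp cond.
have [E' [e' [a [hyp' gE e4 aE [w0 v0u0]]]]] := normal_hypo_frame dV sol hyp.
have Ee := hypo_frameP hyp'; have Lr := hypo_bracket_linear_r hyp'.
have Ka : dx a = 0 /\ dy a = 0 /\ dz a = 0 \/
   4 * dz a = dx a ^+ 2 + dy a ^+ 2 + dz a ^+ 2.
  case: cond => [[xi xiP K]|[nabla LC [tau [nu ric]]]]; [left|right].
    apply: (killing_table Ee aE (xi := xi)) => [x|X Y].
      by rewrite gE e4.
    by rewrite !gE.
  apply: (ricci_table Ee Lr aE (nabla := nabla)).
    case: LC => l1 l2 l3 l4; split=> // X Y Z; rewrite !gE; exact: l4.
  by exists tau, nu => X Y; rewrite ric gE !e4.
have [[p [b aP]]|[r r0 aP]] :=
    jacobi_table_classification (table_jacobi Ee Lr aE) w0 v0u0 Ka; last first.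
  by have := simple_not_solvable Ee Lr aE r0 aP sol.
have [/andP[/eqP p0 /eqP b0]|] := boolP ((p == 0) && (b == 0)).
  by left; apply: (h1_iso Ee Lr aE); rewrite aP p0 b0.
by rewrite negb_and => /orP pb; right; apply: (h3_iso Ee Lr aE pb aP).
Qed.

End Models.

(** * From invariant structures to frames, and solvability of the models *)

Section Main.
Variables (R : realType) (V : vectType R) (L : lieAlgebra V) (dV : \dim {:V} = 5%N).

Lemma hypo_frame_of_coframe (t : 5.-tuple 'Hom(V, R^o)) eta f1 f2 f3 :
  adapted_coframe t eta f1 f2 f3 -> hypo_contact L eta f1 f2 f3 ->
  exists E, hypo_frame L E (fun i x => t`_i x : R).
Proof.
move=> [bt etaE f1E f2E f3E] [_ d1E d3E1 d3E2].
have [E Ee] := frame_of_coframe dV bt.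
exists E; split=> // [X Y|X Y Z T|X Y Z T].
- by have := d1E X Y; rewrite /d1 etaE f3E /w3; lra.
- by have := d3E1 X Y Z T; rewrite /d3 /wedge12 etaE !f1E.
- by have := d3E2 X Y Z T; rewrite /d3 /wedge12 etaE !f2E.
Qed.

Lemma iso_of_K_contact eta f1 f2 f3 : lie_solvable L ->
  K_contact_hypo L eta f1 f2 f3 ->
  lie_isomorphic L (h1 R) \/ lie_isomorphic L (h3 R).
Proof.
move=> sol [hc [g [xi [[t ad gE] xiE K]]]].
(* The frame is dual to the very coframe that computes [g], so its metric is [g]. *)
have [E hyp] := hypo_frame_of_coframe ad hc.
have gM X Y : metric (fun i x => t`_i x : R) X Y = g X Y by rewrite gE.
apply: (iso_of_hypo_frame dV sol hyp); left; exists xi => [x|X Y].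
  by rewrite gM xiE; case: ad => _ ->.
by rewrite !gM; exact: K.
Qed.

Lemma iso_of_eta_Einstein eta f1 f2 f3 : lie_solvable L ->
  hypo_contact_eta_Einstein L eta f1 f2 f3 ->
  lie_isomorphic L (h1 R) \/ lie_isomorphic L (h3 R).
Proof.
move=> sol [hc [g [nabla [[t ad gE] [l1 l2 l3 l4] [tau [nu ric]]]]]].
have [E hyp] := hypo_frame_of_coframe ad hc.
have gM X Y : metric (fun i x => t`_i x : R) X Y = g X Y by rewrite gE.
apply: (iso_of_hypo_frame dV sol hyp); right; exists nabla.
  by split=> // X Y Z; rewrite !gM; exact: l4.
exists tau, nu => X Y; rewrite ric gM; by case: ad => _ ->.
Qed.

Lemma K_contact_of_frame E e : hypo_frame L E e -> killing L (metric e) (E 4%N) ->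
  exists (eta : 'Hom(V, R^o)) (f1 f2 f3 : V -> V -> R),
    K_contact_hypo L eta f1 f2 f3.
Proof.
move=> hyp K; have Ee := hypo_frameP hyp.
have [t bt tE] := coframe_of_frame dV Ee.
exists t`_4, (w1 e), (w2 e), (w3 e).
have ad : adapted_coframe t t`_4 (w1 e) (w2 e) (w3 e).
  by split=> // X Y; rewrite /wedge11 !tE.
split.
  split; first by exists t.
  - by move=> X Y; rewrite /d1 tE // (hypo_eta hyp) mulNr.
  - by move=> X Y Z T; rewrite -[RHS](hypo_w1 hyp X Y Z T) /d3 /wedge12 !tE.
  - by move=> X Y Z T; rewrite -[RHS](hypo_w2 hyp X Y Z T) /d3 /wedge12 !tE.
exists (metric e), (E 4%N); split=> //.
- by exists t => // X Y; apply: eq_bigr => i _; rewrite !tE.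
- by move=> X; rewrite metricC (metric_frame Ee) // tE.
Qed.

Lemma bracketv_ind (P : V -> Prop) (U : {vspace V}) :
  P 0 -> (forall k x y, P x -> P y -> P (k *: x + y)) ->
  (forall x y, x \in U -> y \in U -> P (L x y)) ->
  forall z, z \in bracketv L U U -> P z.
Proof.
move=> P0 PD PL z; rewrite /bracketv; set s := [seq _ | x <- _, y <- _] => zs.
rewrite (@coord_span _ _ _ (in_tuple s) z zs); apply: big_ind => //.
  by move=> x y Px Py; rewrite -[x]scale1r; apply: PD.
move=> i _; rewrite -[_ *: _]addr0; apply: PD => //.
have /allpairsP[[x y] [/= xU yU ->]] : s`_i \in s by apply: mem_nth.
by apply: PL; apply: vbasis_mem.
Qed.

Section Transport.
Variables (M : lieAlgebra 'rV[R]_5) (f : 'Hom(V, 'rV[R]_5)).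
Hypotheses (fb : bijective f) (fM : forall x y, f (L x y) = M (f x) (f y)).

Lemma pullback_frame (Er : nat -> 'rV[R]_5) (er : nat -> 'rV[R]_5 -> R) :
  frame Er er -> exists2 E, (forall i, f (E i) = Er i) & frame E (fun i x => er i (f x)).
Proof.
move=> F; have [g fK gK] := fb; exists (fun i => g (Er i)) => [i|]; first exact: gK.
split.
- by move=> i k x y; rewrite linearP (frame_scalar F).
- by move=> i j i5 j5; rewrite gK (frame_dual F).
- move=> x; apply: (can_inj fK); rewrite {1}(frame_span F (f x)) linear_sum.
  by apply: eq_bigr => i _; rewrite linearZ /= gK.
Qed.

Let vanish (s : seq nat) (x : V) := forall i, i \in s -> f x 0 (inord i) = 0.

Let vanish_derived (s : seq nat) n :
  (forall x y, x \in derived_series L n -> y \in derived_series L n ->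
     vanish s (L x y)) ->
  forall z, z \in derived_series L n.+1 -> vanish s z.
Proof.
apply: bracketv_ind => [i _|k x y vx vy i si]; first by rewrite linear0 mxE.
by rewrite linearP !mxE vx // vy // mulr0 addr0.
Qed.

Let derived_eq0 n : (forall z, z \in derived_series L n -> vanish (iota 0 5) z) ->
  derived_series L n = 0%VS.
Proof.
move=> h; apply/eqP; rewrite -subv0; apply/subvP => z /h vz; rewrite memv0.
apply/eqP/(bij_inj fb); rewrite linear0; apply: row5P => i i5.
by rewrite vz ?mxE // mem_iota.
Qed.

Let minor0 (i j : nat) (x y : V) : f x 0 (inord i.-1) = 0 -> f y 0 (inord i.-1) = 0 ->
  minor (f x) (f y) i j = 0.
Proof. by rewrite /minor => -> ->; rewrite mul0r mulr0 subr0. Qed.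

Lemma h1_solvable : M = h1 R -> lie_solvable L.
Proof.
move=> ME; exists 2%N; apply: derived_eq0.
have D1 z : z \in derived_series L 1 -> vanish [:: 0; 1; 2; 3]%N z.
  apply: vanish_derived => x y _ _ i; rewrite fM ME !inE => hi.
  rewrite [LHS]h1_coordE; last by case/or4P: hi => /eqP ->.
  by case/or4P: hi => /eqP -> /=; rewrite mul0r.
apply: vanish_derived => x y /D1 vx /D1 vy i; rewrite mem_iota fM ME => /= hi.
by rewrite [LHS]h1_coordE // !minor0 ?vx ?vy // addr0 mulr0.
Qed.

(** The successive derived algebras lie in the span of X_1, X_2, X_3, then in the line of X_1, then
    in 0. *)
Lemma h3_solvable : M = h3 R -> lie_solvable L.
Proof.
move=> ME; exists 3%N; apply: derived_eq0.
have D1 z : z \in derived_series L 1 -> vanish [:: 3; 4]%N z.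
  apply: vanish_derived => x y _ _ i; rewrite fM ME !inE => hi.
  rewrite [LHS]h3_coordE; last by case/orP: hi => /eqP ->.
  by case/orP: hi => /eqP ->.
have D2 z : z \in derived_series L 2 -> vanish [:: 1; 2; 3; 4]%N z.
  apply: vanish_derived => x y /D1 vx /D1 vy i; rewrite fM ME !inE => hi.
  rewrite [LHS]h3_coordE; last by case/or4P: hi => /eqP ->.
  rewrite /minor /= !(vx 3%N) // !(vy 3%N) // !(vx 4%N) // !(vy 4%N) //.
  by case/or4P: hi => /eqP -> /=; ring.
apply: vanish_derived => x y /D2 vx /D2 vy i; rewrite mem_iota fM ME => /= hi.
rewrite [LHS]h3_coordE // !(minor0 (i := 2)) ?(minor0 (i := 3)) ?vx ?vy //.
rewrite /minor /= !(vx 3%N) // !(vy 3%N) //.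
by case: i hi => [|[|[|[|[|]]]]] // _ /=; ring.
Qed.

End Transport.
End Main.

(** * K-contact hypo structures on the two models *)

Section Converse.
Variable R : realType.

(** Inverse of the coordinates used in [h1_iso]. *)
Definition h1_coframe i (x : 'rV[R]_5) : R :=
  nth 0 [:: x 0 (inord 0); x 0 (inord 1); x 0 (inord 2); x 0 (inord 3);
            2 * x 0 (inord 4)] i.
Definition h1_frame i : 'rV[R]_5 :=
  \row_(j < 5) nth 0 (nth [::] [:: [:: 1; 0; 0; 0; 0]; [:: 0; 1; 0; 0; 0];
    [:: 0; 0; 1; 0; 0]; [:: 0; 0; 0; 1; 0]; [:: 0; 0; 0; 0; 1 / 2]] i) j.

(** Inverse of the coordinates used in [h3_iso] for p = 1 and b = 0. *)
Definition h3_coframe i (x : 'rV[R]_5) : R :=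
  nth 0 [:: x 0 (inord 3); x 0 (inord 1); x 0 (inord 2); - 2 * x 0 (inord 0);
            2 * x 0 (inord 0) - x 0 (inord 4) / 3] i.
Definition h3_frame i : 'rV[R]_5 :=
  \row_(j < 5) nth 0 (nth [::] [:: [:: 0; 0; 0; 1; 0]; [:: 0; 1; 0; 0; 0];
    [:: 0; 0; 1; 0; 0]; [:: - (1 / 2); 0; 0; 0; - 3]; [:: 0; 0; 0; 0; - 3]] i) j.

Lemma h1_frameP : frame h1_frame h1_coframe.
Proof.
split.
- by move=> i k x y; rewrite /h1_coframe; case: i => [|[|[|[|[|i]]]]] /=;
    rewrite ?nth_nil ?mxE; ring.
- move=> i j i5 j5; rewrite /h1_coframe /h1_frame.
  by case: i i5 => [|[|[|[|[|]]]]] // _; rewrite !mxE !inordK //;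
     case: j j5 => [|[|[|[|[|]]]]] // _ /=; field.
- move=> x; apply: row5P => i i5; expand_sums; rewrite /h1_coframe /h1_frame !mxE !inordK //.
  by case: i i5 => [|[|[|[|[|]]]]] // _ /=; field.
Qed.

Lemma h3_frameP : frame h3_frame h3_coframe.
Proof.
split.
- by move=> i k x y; rewrite /h3_coframe; case: i => [|[|[|[|[|i]]]]] /=;
    rewrite ?nth_nil ?mxE; field.
- move=> i j i5 j5; rewrite /h3_coframe /h3_frame.
  by case: i i5 => [|[|[|[|[|]]]]] // _; rewrite !mxE !inordK //;
     case: j j5 => [|[|[|[|[|]]]]] // _ /=; field.
- move=> x; apply: row5P => i i5; expand_sums; rewrite /h3_coframe /h3_frame !mxE !inordK //.
  by case: i i5 => [|[|[|[|[|]]]]] // _ /=; field.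
Qed.

Variables (V : vectType R) (L : lieAlgebra V) (dV : \dim {:V} = 5%N).

Lemma h1_K_contact : lie_isomorphic L (h1 R) ->
  exists (eta : 'Hom(V, R^o)) (f1 f2 f3 : V -> V -> R),
    K_contact_hypo L eta f1 f2 f3.
Proof.
move=> [f [fb fL]]; have [E fE Ee] := pullback_frame fb h1_frameP.
have {}fL x y k : (k < 5)%N -> f (L x y) 0 (inord k) =
    (k == 4)%N%:R * (minor (f x) (f y) 1 4 + minor (f x) (f y) 2 3).
  by move=> k5; rewrite fL -h1_coordE.
apply: (@K_contact_of_frame _ _ _ dV E (fun i x => h1_coframe i (f x))).
  split=> // [X Y|X Y Z T|X Y Z T].
  - by rewrite /w3 /wedge11 /h1_coframe /= !fL // /minor /=; ring.
  - by rewrite /d3 /wedge12 /w1 /wedge11 /h1_coframe /= !fL // /minor /=; ring.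
  - by rewrite /d3 /wedge12 /w2 /wedge11 /h1_coframe /= !fL // /minor /=; ring.
move=> X Y; rewrite /metric; expand_sums.
by rewrite /h1_coframe /= !fL // /minor /= !fE !mxE !inordK //=; field.
Qed.

Lemma h3_K_contact : lie_isomorphic L (h3 R) ->
  exists (eta : 'Hom(V, R^o)) (f1 f2 f3 : V -> V -> R),
    K_contact_hypo L eta f1 f2 f3.
Proof.
move=> [f [fb fL]]; have [E fE Ee] := pullback_frame fb h3_frameP.
have {}fL x y k : (k < 5)%N -> f (L x y) 0 (inord k) =
    nth 0 [:: 2 * minor (f x) (f y) 1 4 + minor (f x) (f y) 2 3;
              minor (f x) (f y) 2 4 + minor (f x) (f y) 3 5;
              minor (f x) (f y) 3 4 - minor (f x) (f y) 2 5; 0; 0] k.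
  by move=> k5; rewrite fL -h3_coordE.
apply: (@K_contact_of_frame _ _ _ dV E (fun i x => h3_coframe i (f x))).
  split=> // [X Y|X Y Z T|X Y Z T].
  - by rewrite /w3 /wedge11 /h3_coframe /= !fL // /minor /=; field.
  - by rewrite /d3 /wedge12 /w1 /wedge11 /h3_coframe /= !fL // /minor /=; field.
  - by rewrite /d3 /wedge12 /w2 /wedge11 /h3_coframe /= !fL // /minor /=; field.
move=> X Y; rewrite /metric; expand_sums.
by rewrite /h3_coframe /= !fL // /minor /= !fE !mxE !inordK //=; field.
Qed.

End Converse.

Unset Implicit Arguments.
Set Strict Implicit.

Theorem corollary4p4 (R : realType) (V : vectType R) (L : lieAlgebra V)
    (dimV : \dim {:V} = 5%N) :
  (lie_solvable L /\
   ((exists (eta : 'Hom(V, R^o)) (w1 w2 w3 : V -> V -> R),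
       K_contact_hypo L eta w1 w2 w3) \/
    (exists (eta : 'Hom(V, R^o)) (w1 w2 w3 : V -> V -> R),
       hypo_contact_eta_Einstein L eta w1 w2 w3)))
  <-> (lie_isomorphic L (h1 R) \/ lie_isomorphic L (h3 R)).
Proof.
split.
  move=> [sol [[eta [f1 [f2 [f3 K]]]]|[eta [f1 [f2 [f3 K]]]]]].
    exact: iso_of_K_contact sol K.
  exact: iso_of_eta_Einstein sol K.
move=> [iso|iso].
  split; last by left; exact: h1_K_contact iso.
  by case: iso => f [fb fL]; apply: (h1_solvable fb fL).
split; last by left; exact: h3_K_contact iso.
by case: iso => f [fb fL]; apply: (h3_solvable fb fL).
Qed.
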